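(* Let $n\ge 2$ and let $\boldsymbol\mu=(\mu_1,\dots,\mu_n)\in\mathcal M^n$ be a bandit instance of the exponential family described in the context with $\mu_1>\mu_2\ge\dots\ge\mu_n$. Fix $\alpha\in(1,e/2]$. For $\delta\in(0,e^{-e})$ run the Tri-BBAI algorithm with parameters $\epsilon=\frac{1}{\log\log(1/\delta)}$, $L_1=\sqrt{\log(1/\delta)}$, $L_2=\frac{\log(1/\delta)\,\log\log(1/\delta)}{n}$, $L_3=(\log(1/\delta))^2$, the given $\alpha$, and threshold function $\beta(t,\delta)=\log\!\big(\log(1/\delta)\,t^{\alpha}/\delta\big)$, and let $N_\delta$ be its total number of arm pulls. Then $$\limsup_{\delta\to0}\frac{\mathbb E_{\boldsymbol\mu}[N_\delta]}{\log(1/\delta)}\le \alpha\,T^*(\boldsymbol\mu).$$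
   Context: Bandit model. Fix a one-parameter canonical exponential family $\{\nu_\theta\}_{\theta\in\Theta}$ ($\Theta$ an open interval): $\frac{d\nu_\theta}{d\rho}(x)=\exp(x\theta-b(\theta))$ for a reference measure $\rho$ on $\mathbb R$, with $b(\theta)=\log\int e^{x\theta}d\rho(x)$. The mean map $\theta\mapsto b'(\theta)$ is a bijection from $\Theta$ onto an open interval $\mathcal M$, so members of the family are indexed by their mean. For $\mu,\mu'\in\mathcal M$, $d(\mu,\mu')$ denotes the Kullback–Leibler divergence from the member with mean $\mu$ to the member with mean $\mu'$. An instance is $\boldsymbol\mu\in\mathcal M^n$; pulling arm $i$ yields a fresh independent sample from the member with mean $\mu_i$. All logarithms are natural. Characteristic time. For $\boldsymbol\lambda\in\mathcal M^n$ and an index $k$ with $\lambda_k>\lambda_j$ for all $j\ne k$, let $\mathrm{Alt}_k(\boldsymbol\lambda)=\{\boldsymbol\lambda'\in\mathcal M^n:\lambda'_j>\lambda'_k\text{ for some }j\neq k\}$, $\mathcal P_n$ the probability simplex in $\mathbb R^n$, and $T^*(\boldsymbol\lambda)^{-1}=\sup_{\mathbf w\in\mathcal P_n}\inf_{\boldsymbol\lambda'\in\mathrm{Alt}_k(\boldsymbol\lambda)}\sum_{i=1}^n w_i\,d(\lambda_i,\lambda'_i)$, with $\mathbf w^*(\boldsymbol\lambda)\in\mathcal P_n$ the (unique) maximizer. For the instance, $T^*(\boldsymbol\mu)$ is taken with $k=1$. Notation during a run. After $t$ total pulls, $N_i(t)$ is the number of pulls of arm $i$, $\hat\mu_i(t)$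 the empirical mean of its samples, $i^*(t)\in\arg\max_i\hat\mu_i(t)$ (ties broken by smallest index). For arms $i,j$: $\hat\mu_{ij}(t)=\frac{N_i(t)\hat\mu_i(t)+N_j(t)\hat\mu_j(t)}{N_i(t)+N_j(t)}$; if $\hat\mu_i(t)\ge\hat\mu_j(t)$, $Z_{ij}(t)=N_i(t)\,d(\hat\mu_i(t),\hat\mu_{ij}(t))+N_j(t)\,d(\hat\mu_j(t),\hat\mu_{ij}(t))$, and $Z_j(t)=Z_{i^*(t)j}(t)$. Tri-BBAI algorithm (parameters $\delta,\epsilon,L_1,L_2,L_3,\alpha,\beta$). Stage I (one batch): pull every arm $\lceil L_1\rceil$ times; set $T_i^0=L_1$ for all $i$ and $\mathbf w^*(\mathbf b^0)=(1/n,\dots,1/n)$. Stage II: for $q=1,2,\dots,\lceil\log(1/\delta)\rceil$, with $t$ the current total number of pulls, set $b^q_i=\hat\mu_i(t)+\epsilon$ for $i\ne i^*(t)$ and $b^q_{i^*(t)}=\hat\mu_{i^*(t)}(t)-\epsilon$; compute $\mathbf w^*(\mathbf b^q)$ and $T^*(\mathbf b^q)$ with designated index $k=i^*(t)$ (convention: if $\mathbf b^q\notin\mathcal M^n$ or $i^*(t)$ is not the unique maximal coordinate of $\mathbf b^q$, set $\mathbf w^*(\mathbf b^q)$ uniform and $T^*(\mathbf b^q)=+\infty$); let $T_i^q=\min\{\alpha\,w_i^*(\mathbf b^q)T^*(\mathbf b^q)\log(1/\delta),\,L_2\}$; in one batch pull each arm $i$ exactly $\max\{0,\lceil T_i^q\rceil-\lceil\max_{0\le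 p<q}T_i^p\rceil\}$ times; then if $|w_i^*(\mathbf b^q)-w_i^*(\mathbf b^{q-1})|\le 1/\sqrt n$ for all $i\in[n]$, leave Stage II. Stage III: let $\tau$ be the current total number of pulls; if $\min_{j\ne i^*(\tau)}Z_j(\tau)\ge\beta(\tau,\delta/2)$, stop and output $i^*(\tau)$. Stage IV (one batch, only if Stage III did not stop): pull each arm $i$ an additional $\max\{0,\lceil L_3\rceil-N_i(\tau)\}$ times and output the arm with largest empirical mean. The batch complexity is the number of batches used (Stage I, each executed iteration of Stage II, and Stage IV if executed). *)

(* Defs.v *)
From HB Require Import structures.
From mathcomp Require Import all_boot all_order all_algebra.
From mathcomp Require Import all_classical all_reals all_analysis.
Set Implicit Arguments. Unset Strict Implicit. Unset Printing Implicit Defensive.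
Import Order.TTheory GRing.Theory Num.Theory.
Local Open Scope ring_scope.
Local Open Scope classical_set_scope.

Definition is_open_interval {R : realType} (S : set R) : Prop :=
  exists a b : \bar R, (a < b)%E /\ S = [set x : R | (a < x%:E < b)%E].

Definition indep_family {R : realType} {d} {Omega : measurableType d}
  (P : probability Omega R) {I : eqType} (X : I -> Omega -> R) : Prop :=
  forall (s : seq I) (B : I -> set R), uniq s -> (forall j, measurable (B j)) ->
    P (\bigcap_(j in [set` s]) (X j @^-1` B j)) = (\prod_(j <- s) P (X j @^-1` B j))%E.

Section ExpFamily.
Variable R : realType.
Variable rho : {measure set R -> \bar R}.
Variable Theta : set R.

Definition bfun (th : R) : R := ln (fine (\int[rho]_x (expR (x * th))%:E)%E).
Definition dens (th x : R) : R := expR (x * th - bfun th).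
Definition nu (th : R) (B : set R) : \bar R := (\int[rho]_(x in B) (dens th x)%:E)%E.
Definition meanmap : R -> R := derive1 bfun.
Definition Mset : set R := meanmap @` Theta.
Definition theta_of (m : R) : R := xget 0 [set th | Theta th /\ meanmap th = m].
(* KL(nu_th || nu_th') = \int log(d nu_th / d nu_th') d nu_th *)
Definition kl (th th' : R) : \bar R :=
  (\int[rho]_x (dens th x * (x * (th - th') - bfun th + bfun th'))%:E)%E.
Definition dKL (m m' : R) : \bar R := kl (theta_of m) (theta_of m').
(* convention for arguments outside M (e.g. empirical means): the lower
   semicontinuous envelope of d (= usual extension by continuity; +oo outside
   the closure of M x M). *)
Definition dext (x y : R) : \bar R :=
  if `[< Mset x /\ Mset y >] then dKL x y
  else ereal_sup [set ereal_inf [set dKL p.1 p.2 | p in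
         [set p : R * R | Mset p.1 /\ Mset p.2 /\ `|p.1 - x| < e /\ `|p.2 - y| < e]]
       | e in [set e : R | 0 < e]].

Section CharTime.
Variable n : nat.
Definition simplex : set {ffun 'I_n -> R} :=
  [set w | (forall i, 0 <= w i) /\ \sum_i w i = 1].
Definition Alt (k : 'I_n) : set ('I_n -> R) :=
  [set lam' | (forall i, Mset (lam' i)) /\ exists j, j != k /\ lam' k < lam' j].
Definition objective (lam : 'I_n -> R) (k : 'I_n) (w : {ffun 'I_n -> R}) : \bar R :=
  ereal_inf [set (\sum_(i < n) (w i)%:E * dKL (lam i) (lam' i))%E | lam' in Alt k].
Definition Tinv (lam : 'I_n -> R) (k : 'I_n) : \bar R :=
  ereal_sup [set objective lam k w | w in simplex].
Definition uniformw : {ffun 'I_n -> R} := [ffun => n%:R^-1].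
Definition wstar (lam : 'I_n -> R) (k : 'I_n) : {ffun 'I_n -> R} :=
  xget uniformw [set w | simplex w /\ objective lam k w = Tinv lam k].
Definition TstarMu (lam : 'I_n -> R) : R :=
  match [pick k | [forall j, (j != k) ==> (lam j < lam k)]] with
  | Some k => (fine (Tinv lam k))^-1
  | None => 0
  end.

Variables (alpha delta : R).
Definition logd : R := ln delta^-1.
Definition eps : R := (ln logd)^-1.
Definition L1 : R := Num.sqrt logd.
Definition L2 : R := logd * ln logd / n%:R.
Definition L3 : R := logd ^+ 2.
Definition cnat (x : R) : nat := `|Num.ceil x|%N.     (* ceiling, for x >= 0 *)
Definition Qmax : nat := cnat logd.
Definition beta (t : nat) (dl : R) : R := ln (ln dl^-1 * (t%:R `^ alpha) / dl).

(* s i k = (k+1)-th sample of arm i *)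
Variable s : 'I_n -> nat -> R.
Definition emp (N : 'I_n -> nat) (i : 'I_n) : R := (\sum_(k < N i) s i k) / (N i)%:R.
Definition is_istar (N : 'I_n -> nat) (i : 'I_n) : bool :=
  [forall j : 'I_n, emp N j <= emp N i] && [forall j : 'I_n, (j < i)%N ==> (emp N j < emp N i)].
Definition istar (N : 'I_n -> nat) : option 'I_n := [pick i | is_istar N i].
Definition Zij (N : 'I_n -> nat) (i j : 'I_n) : \bar R :=
  let mi := emp N i in let mj := emp N j in
  let mij := ((N i)%:R * mi + (N j)%:R * mj) / (N i + N j)%:R in
  ((N i)%:R%:E * dext mi mij + (N j)%:R%:E * dext mj mij)%E.
Definition bvec (N : 'I_n -> nat) (k : 'I_n) : 'I_n -> R :=
  fun i => if i == k then emp N i - eps else emp N i + eps.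
Definition valid_b (b : 'I_n -> R) (k : 'I_n) : bool :=
  `[< forall i, Mset (b i) >] && [forall j, (j != k) ==> (b j < b k)].
Definition step_targets (N : 'I_n -> nat) : {ffun 'I_n -> R} * ('I_n -> R) :=
  match istar N with
  | Some k =>
      let b := bvec N k in
      if valid_b b k then
        (wstar b k,
         fun i => Num.min (alpha * wstar b k i * (fine (Tinv b k))^-1 * logd) L2)
      else (uniformw, fun _ => L2)   (* T^* = +oo, w^* uniform *)
  | None => (uniformw, fun _ => L2)
  end.
(* Stage II: at most fuel iterations; mT i = max_{p<q} T_i^p; wprev = w^*(b^{q-1}) *)
Fixpoint stage2 (fuel : nat) (N : 'I_n -> nat) (mT wprev : 'I_n -> R) : 'I_n -> nat :=
  match fuel with
  | 0 => N
  | f.+1 =>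
      let wT := step_targets N in
      let w := wT.1 in let T := wT.2 in
      let N' := fun i => addn (N i) (absz (Num.max 0%Z (Num.ceil (T i) - Num.ceil (mT i)))) in
      let mT' := fun i => Num.max (mT i) (T i) in
      if [forall i, `|w i - wprev i| <= (Num.sqrt n%:R)^-1] then N'
      else stage2 f N' mT' (fun i => w i)
  end.
Definition N_stage1 : 'I_n -> nat := fun _ => cnat L1.
Definition N_stage2 : 'I_n -> nat :=
  stage2 Qmax N_stage1 (fun _ => L1) (fun _ => n%:R^-1).
Definition tau : nat := (\sum_i N_stage2 i)%N.
Definition stop3 : bool :=
  match istar N_stage2 with
  | Some k => [forall j, (j != k) ==> ((beta tau (delta / 2))%:E <= Zij N_stage2 k j)%E]
  | None => false
  end.
Definition Ntotal : nat :=
  if stop3 then tau else (\sum_i maxn (N_stage2 i) (cnat L3))%N.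
End CharTime.
End ExpFamily.

(* Main.v *)
(** Write [L = log(1/delta)].  In an exponential family [d] is the Bregman divergence of the
    log-partition function, because the derivative of that function is the mean.  The objective of
    the characteristic time is then the minimum over [j <> k] of the weighted divergences to the
    weighted mean, it varies little with the instance, uniformly in the weights, and its maximizer
    is unique; by compactness [T^*] and [w^*] are continuous at [mu].

    As long as the empirical means stay close to [mu], every target computed in Stage II is
    [L * (alpha * w^*_i(mu) * T^*(mu) + o(1))].  The number of pulls of an arm being the ceiling of
    the largest of its targets, Stage II ends with at most [(alpha * T^*(mu) + o(1)) * L] pulls,
    whenever it is left.  The statistics of Stage III are then at least [(alpha - o(1)) * L], which
    exceeds the threshold [L + O(log L)] because [alpha > 1], so the algorithm stops.
    In all cases it makes at most [n * (L^2 + 1)] pulls, and since every arm is pulled at least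
    [sqrt L] times, Chernoff's bound makes a deviation of an empirical mean too unlikely to matter. *)

Require Import Defs.
From HB Require Import structures.
From mathcomp Require Import all_boot all_order all_algebra.
From mathcomp Require Import all_classical all_reals all_analysis.
From mathcomp Require Import measurable_realfun.
From mathcomp Require Import zify ring lra.
Set Implicit Arguments. Unset Strict Implicit. Unset Printing Implicit Defensive.
Import Order.TTheory GRing.Theory Num.Theory.
Import numFieldNormedType.Exports.
Local Open Scope ring_scope.
Local Open Scope classical_set_scope.

(** * Integration and independence *)

Section transfer.
Context {R : realType}.
Import HBNNSimple.

(** The number of pulls of an arm depends on the samples, so its empirical mean has to be accurate
    for all counts from [cnat (L1 delta)] to [cnat (L3 delta)] at once. The union bound over these
    counts costs a power of [L], which an exponential in [- sqrt L] absorbs. The targets go through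
    a choice of maximizer, so the expectation is not split along events: [Ntotal] is bounded
    pointwise by a constant plus multiples of exponential tilts, and this measurable majorant is
    integrated. The weights behind the last targets belong to a shifted instance [b] formed before
    the last batch, while Stage III evaluates divergences at the final empirical means. Hence
    stability is stated for two instances near [mu], one giving the weights and one the divergences.
    No second derivative of the log-partition function is used: convexity enters as a tangent
    inequality, and the mean map and its inverse are continuous because they are monotone bijections
    between intervals. *)

Lemma integral_mul_nnsfun_comp d (T : measurableType d)
    (m : {measure set T -> \bar R}) (G Y : T -> R) (h : {nnsfun R >-> R}) :
  (forall x, 0 <= G x) -> measurable_fun setT G -> measurable_fun setT Y ->
  (\int[m]_x (G x * h (Y x))%:E =
   \sum_(y \in range h) y%:E * \int[m]_x (G x * \1_(h @^-1` [set y]) (Y x))%:E)%E.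
Proof.
move=> G0 mG mY.
have mI y : measurable_fun [set: T] (fun x => (G x * \1_(h @^-1` [set y]) (Y x))%:E).
  apply/measurable_EFinP/measurable_funM => //.
  exact: (measurableT_comp (measurable_indic _)).
have I0 y x : (0 <= (G x * \1_(h @^-1` [set y]) (Y x))%:E)%E.
  by rewrite lee_fin mulr_ge0.
transitivity (\int[m]_x (\sum_(y \in range h)
    (y%:E * (G x * \1_(h @^-1` [set y]) (Y x))%:E)))%E.
  apply: eq_integral => x _; rewrite (fimfunE h) mulr_fsumr//.
  rewrite -fsumEFin//; apply: eq_fsbigr => y _.
  by rewrite -EFinM mulrCA.
(* Exchanging sum and integral asks for non-negative terms at every real [y], also outside the range
   of [h]; hence the absolute value. *)
rewrite (_ : (fun x => _) = (fun x => (\sum_(y \in range h)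
   ((`|y|)%:E * (G x * \1_(h @^-1` [set y]) (Y x))%:E))%E)); last first.
  apply/funext => x; apply: eq_fsbigr => y /[!inE] -[t _ <-].
  by rewrite ger0_norm.
rewrite ge0_integral_fsum//; last 2 first.
- by move=> y; apply: measurable_funeM.
- by move=> y x _; rewrite mule_ge0 ?lee_fin// mulr_ge0.
apply: eq_fsbigr => y /[!inE] -[t _ <-].
by rewrite ger0_norm// ge0_integralZl// lee_fin.
Qed.

(** Both sides are limits over the same simple functions of the values, which only see level sets.
    The weights make one lemma serve twice: [G1] as the product of the other factors in a product of
    independent variables, [G2] as the density of a sample with respect to [rho]. *)
Lemma integral_mul_comp_transfer d1 d2 (T1 : measurableType d1) (T2 : measurableType d2)
    (m1 : {measure set T1 -> \bar R}) (m2 : {measure set T2 -> \bar R})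
    (G1 Y1 : T1 -> R) (G2 Y2 : T2 -> R) (f : R -> R) :
  (forall x, 0 <= G1 x) -> measurable_fun setT G1 -> measurable_fun setT Y1 ->
  (forall x, 0 <= G2 x) -> measurable_fun setT G2 -> measurable_fun setT Y2 ->
  (forall B, measurable B -> (\int[m1]_x (G1 x * \1_B (Y1 x))%:E =
                              \int[m2]_x (G2 x * \1_B (Y2 x))%:E)%E) ->
  (forall x, 0 <= f x) -> measurable_fun setT f ->
  (\int[m1]_x (G1 x * f (Y1 x))%:E = \int[m2]_x (G2 x * f (Y2 x))%:E)%E.
Proof.
move=> G10 mG1 mY1 G20 mG2 mY2 E f0 mf.
have f0E t : (0 <= (EFin \o f) t)%E by rewrite lee_fin.
have mfE : measurable_fun setT (EFin \o f) by apply/measurable_EFinP.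
pose h := nnsfun_approx measurableT mfE.
have L d (T : measurableType d) (m : {measure set T -> \bar R}) (G Y : T -> R) :
  (forall x, 0 <= G x) -> measurable_fun setT G -> measurable_fun setT Y ->
  (\int[m]_x (G x * f (Y x))%:E =
   limn (fun n => \int[m]_x (G x * h n (Y x))%:E))%E.
  move=> G0 mG mY; rewrite -monotone_convergence//.
  - apply: eq_integral => x _; apply/esym/cvg_lim => //.
    have : (EFin \o (h ^~ (Y x))) n @[n --> \oo] --> (f (Y x))%:E.
      exact: (@cvg_nnsfun_approx _ _ _ _ measurableT _ mfE (fun t _ => f0E t) (Y x) Logic.I).
    by rewrite EFinM => /(cvgeZl (y := (G x)%:E)); apply.
  - move=> n; apply/measurable_EFinP/measurable_funM => //.
    exact: measurableT_comp.
  - by move=> n x _; rewrite lee_fin mulr_ge0.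
  - move=> x _ a b ab; rewrite lee_fin ler_wpM2l//.
    exact/lefP/nd_nnsfun_approx.
rewrite !L//; congr (limn _); apply/funext => n.
rewrite !integral_mul_nnsfun_comp//; apply: eq_fsbigr => y _.
by rewrite E.
Qed.

(** The integral of a non-negative function is the supremum over the simple functions below it, so
    it is monotone on arbitrary non-negative functions. It is applied to [Ntotal], which depends on
    the samples through the choice [wstar]. *)
Lemma le_ge0_integral_nomeas d (T : measurableType d) (m : {measure set T -> \bar R})
    (f g : T -> \bar R) :
  (forall x, 0 <= f x)%E -> (forall x, f x <= g x)%E ->
  (\int[m]_x f x <= \int[m]_x g x)%E.
Proof.
move=> f0 fg; have g0 x : (0 <= g x)%E by exact: le_trans (fg x).
rewrite !ge0_integralTE//; apply: ereal_sup_le => _ [h /= hf <-].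
by exists h => // x; exact: le_trans (fg x).
Qed.

End transfer.

Section indep.
Context {R : realType} {d : measure_display} {Omega : measurableType d}.
Variable P : probability Omega R.

Lemma indep_expectation_prod (I : choiceType) (X : I -> Omega -> R) (f : I -> R -> R)
    (s : seq I) :
  indep_family P X -> (forall i, measurable_fun setT (X i)) ->
  (forall i x, 0 <= f i x) -> (forall i, measurable_fun setT (f i)) ->
  (forall i, (\int[P]_w (f i (X i w))%:E < +oo)%E) -> uniq s ->
  (\int[P]_w (\prod_(i <- s) f i (X i w))%:E =
   \prod_(i <- s) \int[P]_w (f i (X i w))%:E)%E.
Proof.
move=> indX mX f0 mf ffin us.
(* the functions are replaced by indicators one factor at a time *)
suff H (s2 s1 : seq I) (B : I -> set R) : uniq (s2 ++ s1) -> (forall i, measurable (B i)) ->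
  (\int[P]_w (\prod_(i <- s2) f i (X i w) * \prod_(i <- s1) \1_(B i) (X i w))%:E =
   \prod_(i <- s2) \int[P]_w (f i (X i w))%:E * \prod_(i <- s1) P (X i @^-1` B i))%E.
  have := H s [::] (fun=> setT); rewrite cats0 big_nil mule1 => /(_ us (fun=> measurableT)) <-.
  by apply: eq_integral => w _; rewrite big_nil mulr1.
have If i : (\int[P]_w (f i (X i w))%:E)%E \is a fin_num.
  by rewrite ge0_fin_numE// integral_ge0// => w _; rewrite lee_fin.
elim: s2 s1 B => [|i s2 IH] s1 B.
  rewrite /= big_nil mul1e => us1 mB; rewrite -indX//.
  rewrite -[X in P X]setIT -integral_indic//; last first.
    rewrite bigcap_seq; apply: bigsetI_measurable => j _.
    by rewrite -[_ @^-1` _]setTI; exact: mX.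
  apply: eq_integral => w _; rewrite big_nil mul1r; congr EFin.
  rewrite [RHS]indicE bigcap_seq; elim: (s1) => [|j s' IHs].
    by rewrite !big_nil in_setT.
  rewrite !big_cons in_setI IHs indicE -[w \in X j @^-1` B j]/(X j w \in B j).
  by case: (X j w \in B j); rewrite ?mul1r ?mul0r.
rewrite cat_cons cons_uniq mem_cat negb_or => /andP[/andP[is2 is1] us21] mB.
have mprod (t1 t2 : seq I) C : (forall i, measurable (C i)) -> measurable_fun setT
    (fun w => \prod_(i <- t1) f i (X i w) * \prod_(i <- t2) \1_(C i) (X i w)).
  move=> mC; apply: measurable_funM; apply: measurable_prod => j _; first exact: measurableT_comp.
  exact: (measurableT_comp (measurable_indic _)).
have prod0 (t1 t2 : seq I) (C : I -> set R) w : 0 <= \prod_(i <- t1) f i (X i w) * \prod_(i <- t2) \1_(C i) (X i w).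
  by rewrite mulr_ge0// prodr_ge0.
(* Against functions of [X i], the remaining factors act like the constant weight [c]: for an
   indicator this is the induction hypothesis with [i] moved to [s1], and the transfer lemma extends
   it to [f i]. *)
pose c := fine (\prod_(i <- s2) \int[P]_w (f i (X i w))%:E * \prod_(i <- s1) P (X i @^-1` B i))%E.
have cE : c%:E = (\prod_(i <- s2) \int[P]_w (f i (X i w))%:E * \prod_(i <- s1) P (X i @^-1` B i))%E.
  rewrite fineK// fin_numM//; apply: (big_ind (fun x : \bar R => x \is a fin_num)) => //.
  - by move=> x y fx fy; rewrite fin_numM.
  - by move=> x y fx fy; rewrite fin_numM.
  - by move=> j _; apply: fin_num_measure; rewrite -[_ @^-1` _]setTI; exact: mX.
have c0 : 0 <= c.
  rewrite -lee_fin cE mule_ge0//; apply: prode_ge0 => j _//.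
  by apply: integral_ge0 => w _; rewrite lee_fin.
have := @integral_mul_comp_transfer R _ _ _ _ P P
  (fun w => \prod_(i <- s2) f i (X i w) * \prod_(i <- s1) \1_(B i) (X i w)) (X i)
  (fun=> c) (X i) (f i) (prod0 _ _ _) (mprod _ _ _ mB) (mX i) (fun=> c0) (measurable_cst _) (mX i) _
  (f0 i) (mf i).
move=> /[dup] tr; have -> : (\int[P]_w (\prod_(j <- i :: s2) f j (X j w) * \prod_(j <- s1) \1_(B j) (X j w))%:E =
  \int[P]_w (\prod_(j <- s2) f j (X j w) * \prod_(j <- s1) \1_(B j) (X j w) * f i (X i w))%:E)%E.
  by apply: eq_integral => w _; rewrite big_cons -mulrA mulrC.
move=> _; rewrite {}tr; last first.
  move=> C mC.
  pose B' := fun j => if j == i then C else B j.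
  have mB' j : measurable (B' j) by rewrite /B'; case: ifP.
  have B's1 (F : I -> set R -> R) : \prod_(j <- s1) F j (B' j) = \prod_(j <- s1) F j (B j).
    apply: eq_big_seq => j js; rewrite /B'; case: eqP => // ji; by rewrite -ji js in is1.
  transitivity (\int[P]_w (\prod_(j <- s2) f j (X j w) * \prod_(j <- i :: s1) \1_(B' j) (X j w))%:E)%E.
    apply: eq_integral => w _; rewrite big_cons {1}/B' eqxx (B's1 (fun j A => \1_A (X j w))).
    by congr EFin; ring.
  rewrite IH//; last by rewrite (perm_uniq (permEl (perm_catCA s2 [:: i] s1)))/= mem_cat negb_or is2 is1.
  rewrite big_cons {1}/B' eqxx.
  have -> : (\prod_(j <- s1) P (X j @^-1` B' j) = \prod_(j <- s1) P (X j @^-1` B j))%E.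
    apply: eq_big_seq => j js; rewrite /B'; case: eqP => // ji; by rewrite -ji js in is1.
  rewrite muleCA -cE muleC.
  under eq_integral do rewrite EFinM.
  rewrite ge0_integralZl//; last first.
    by apply/measurable_EFinP; exact: (measurableT_comp (measurable_indic _)).
  congr (_ * _)%E; rewrite -[X in P X]setIT -integral_indic//.
  by rewrite -[_ @^-1` _]setTI; exact: mX.
under eq_integral do rewrite EFinM.
rewrite ge0_integralZl//; last first.
- by move=> w _; rewrite lee_fin.
- by apply/measurable_EFinP; exact: measurableT_comp.
by rewrite cE big_cons [LHS]muleC muleA.
Qed.

End indep.

(** * Exponential families *)

Lemma open_interval_nbhs {R : realType} (S : set R) : is_open_interval S ->
  forall x, S x -> exists2 r : R, 0 < r & forall y, `|y - x| < r -> S y.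
Proof.
move=> [a [b [_ ->]]] x /= /andP[ax xb].
have [r1 r10 h1] : exists2 r1, 0 < r1 & forall y, x - r1 < y -> (a < y%:E)%E.
  case: a ax => [a| |] //; last by exists 1 => // y _; rewrite ltNyr.
  rewrite lte_fin => ax; exists (x - a) => [|y]; rewrite ?subr_gt0 ?lte_fin//; lra.
have [r2 r20 h2] : exists2 r2, 0 < r2 & forall y, y < x + r2 -> (y%:E < b)%E.
  case: b xb => [b| |] //; last by exists 1 => // y _; rewrite ltry.
  rewrite lte_fin => xb; exists (b - x) => [|y]; rewrite ?subr_gt0 ?lte_fin//; lra.
exists (Num.min r1 r2) => [|y]; first by rewrite lt_min r10.
by rewrite lt_min !ltr_norml => /andP[/andP[? _] /andP[_ ?]]; rewrite h1 ?h2//; lra.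
Qed.

Lemma open_interval_between {R : realType} (S : set R) : is_open_interval S ->
  forall x y z, S x -> S z -> x <= y <= z -> S y.
Proof.
move=> [a [b [ab ->]]] x y z /= /andP[ax xb] /andP[az zb] /andP[xy yz].
rewrite (lt_le_trans ax) ?lee_fin//= (le_lt_trans _ zb)// lee_fin //.
Qed.

(** A [y] between [f (g y0 - q)] and [f (g y0 + q)] has [g y] within [q] of [g y0]. The lemma is
    used in both directions: for [theta_of] as section of [meanmap], with the log-partition function
    as [F], and for [meanmap] as section of [theta_of]. *)
Lemma increasing_section_continuous {R : realType} (S M : set R) (f g F : R -> R) y0 e :
  is_open_interval S -> is_open_interval M ->
  (forall t, S t -> M (f t)) -> (forall y, M y -> S (g y) /\ f (g y) = y) ->
  (forall t t', S t -> S t' -> t < t' -> f t < f t') ->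
  (forall t, S t -> {for t, continuous F}) ->
  M y0 -> 0 < e -> exists2 r : R, 0 < r & forall y, `|y - y0| < r ->
    [/\ M y, `|g y - g y0| < e & `|F (g y) - F (g y0)| < e].
Proof.
move=> oS oM fM gP f_lt cF My0 e0; have [T0 e1] := gP _ My0; set th0 := g y0 in T0 e1 *.
have [r r0 rT] := open_interval_nbhs oS T0.
have /cvgrPdist_lt /(_ e e0) /nbhs_ballP[r' /= r'0 r'B] := cF _ T0.
pose q := Num.min (Num.min r r') e / 2.
have mq : 0 < Num.min (Num.min r r') e by rewrite !lt_min r0 r'0 e0.
have [q0 qr qr' qe] : [/\ 0 < q, q < r, q < r' & q < e].
  have h : q < Num.min (Num.min r r') e by rewrite /q; lra.
  by move: h; rewrite !lt_min => /andP[/andP[? ?] ?]; split=> //; rewrite divr_gt0.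
have T1 : S (th0 - q) by apply: rT; rewrite addrC addKr normrN gtr0_norm.
have T2 : S (th0 + q) by apply: rT; rewrite addrC addKr gtr0_norm.
have l1 : f (th0 - q) < y0 by rewrite -e1; apply: f_lt => //; lra.
have l2 : y0 < f (th0 + q) by rewrite -e1; apply: f_lt => //; lra.
exists (Num.min (y0 - f (th0 - q)) (f (th0 + q) - y0)).
  by rewrite lt_min !subr_gt0 l1.
move=> y; rewrite lt_min => /andP[]; rewrite {1}ltr_norml => /andP[z1 _].
rewrite ltr_norml => /andP[_ z2].
have My : M y by apply: (open_interval_between oM (fM _ T1) (fM _ T2)); apply/andP; split; lra.
have [T3 e3] := gP _ My.
have f_le t t' : S t -> S t' -> t <= t' -> f t <= f t'.
  move=> Tt Tt'; rewrite le_eqVlt => /orP[/eqP -> //|/(f_lt _ _ Tt Tt') /ltW//].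
have dq : `|g y - th0| < q.
  rewrite ltr_norml; apply/andP; split; rewrite ltNge; apply/negP => h.
    have := f_le _ _ T3 T1; rewrite e3 => /(_ ltac:(lra)); lra.
  have := f_le _ _ T2 T3; rewrite e3 => /(_ ltac:(lra)); lra.
split=> //; first exact: lt_trans dq qe.
by rewrite distrC; apply: r'B; rewrite /ball /= distrC; exact: lt_trans dq qr'.
Qed.

(** Two opposite exponential tilts dominate the identity. Both are integrable for small [h] because
    [Theta] is open, so every member of the family has a mean. *)
Lemma mul_norm_le_expRD {R : realType} (x h : R) :
  h * `|x| <= expR (x * h) + expR (x * - h).
Proof.
have e1 := expR_ge1Dx (x * h); have e2 := expR_ge1Dx (x * - h).
have e3 := expR_gt0 (x * h); have e4 := expR_gt0 (x * - h).
by have [x0|x0] := lerP 0 x; [rewrite ger0_norm//|rewrite ltr0_norm//]; lra.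
Qed.

Section expfam.
Context {R : realType} (rho : {measure set R -> \bar R}) (Theta : set R).
Hypothesis hTheta : is_open_interval Theta.
Hypothesis hfin : forall th, Theta th -> (\int[rho]_x (expR (x * th))%:E < +oo)%E.
Hypothesis hder : forall th, Theta th -> derivable (bfun rho) th 1.
Hypothesis rho0 : rho setT != 0%E.

Local Notation B := (bfun rho).

Let mexp (c : R) : measurable_fun setT (fun x : R => expR (x * c)).
Proof.
apply: measurableT_comp; first exact: measurable_expR.
by apply: measurable_funM.
Qed.

(** [ln] and [fine] are total, so inverting [bfun] takes finiteness and positivity of the integral.
    Positivity comes from [rho0]: a positive function with zero integral makes the whole line
    negligible. *)
Lemma partition_fun_expR th : Theta th ->
  (\int[rho]_x (expR (x * th))%:E = (expR (B th))%:E)%E.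
Proof.
move=> Tt; have fz : (\int[rho]_x (expR (x * th))%:E)%E \is a fin_num.
  by rewrite ge0_fin_numE ?hfin// integral_ge0// => x _; rewrite lee_fin expR_ge0.
rewrite /bfun lnK ?fineK// posrE fine_gt0// hfin// andbT lt0e integral_ge0 ?andbT; last first.
  by move=> x _; rewrite lee_fin expR_ge0.
apply/eqP => I0; move/eqP: rho0; apply.
have : (\int[rho]_x `|(expR (x * th))%:E| = 0)%E.
  by rewrite -[RHS]I0; apply: eq_integral => x _; rewrite gee0_abs// lee_fin expR_ge0.
have me : measurable_fun setT (fun x : R => (expR (x * th))%:E) by apply/measurable_EFinP.
move=> /(ae_eq_integral_abs rho measurableT me).
move=> [N [mN N0 sub]]; apply/eqP; rewrite -measure_le0 -N0; apply: le_measure; rewrite ?inE//.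
move=> x _; apply: sub => /= /(_ Logic.I) [] /eqP; by rewrite gt_eqF// expR_gt0.
Qed.

Let mdens th : measurable_fun setT (dens rho th).
Proof.
apply: measurableT_comp; first exact: measurable_expR.
by apply: measurable_funB => //; exact: measurable_funM.
Qed.

Lemma dens_mgf th h : Theta th -> Theta (th + h) ->
  (\int[rho]_x (dens rho th x * expR (x * h))%:E = (expR (B (th + h) - B th))%:E)%E.
Proof.
move=> Tt Tth.
rewrite (eq_integral (fun x : R => ((expR (- B th))%:E * (expR (x * (th + h)))%:E)%E)); last first.
  by move=> x _; rewrite /dens -expRD -EFinM -expRD; congr (expR _)%:E; ring.
rewrite ge0_integralZl ?lee_fin ?expR_ge0//; last exact/measurable_EFinP.
by rewrite partition_fun_expR// -EFinM -expRD addrC.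
Qed.

Lemma dens_mgf_integrable th h : Theta th -> Theta (th + h) ->
  rho.-integrable setT (fun x : R => (dens rho th x * expR (x * h))%:E).
Proof.
move=> Tt Tth; apply/integrableP; split.
  by apply/measurable_EFinP; exact: measurable_funM.
rewrite (eq_integral (fun x : R => (dens rho th x * expR (x * h))%:E)).
  by rewrite dens_mgf// ltry.
by move=> x _; rewrite gee0_abs// lee_fin mulr_ge0 ?expR_ge0.
Qed.

Lemma dens_integral1 th : Theta th -> (\int[rho]_x (dens rho th x)%:E = 1)%E.
Proof.
move=> Tt; have := @dens_mgf th 0; rewrite addr0 subrr expR0 => /(_ Tt Tt) <-.
by apply: eq_integral => x _; rewrite mulr0 expR0 mulr1.
Qed.

Lemma dens_integrable th : Theta th -> rho.-integrable setT (fun x : R => (dens rho th x)%:E).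
Proof.
move=> Tt; have := @dens_mgf_integrable th 0; rewrite addr0 => /(_ Tt Tt).
by apply: eq_integrable => // x _; rewrite mulr0 expR0 mulr1.
Qed.

Lemma dens_id_integrable th : Theta th -> rho.-integrable setT (fun x : R => (dens rho th x * x)%:E).
Proof.
move=> Tt; have [r r0 rT] := open_interval_nbhs hTheta Tt.
pose h := r / 2; have h0 : 0 < h by rewrite divr_gt0.
have hr : h < r by rewrite /h; lra.
have T1 : Theta (th + h) by apply: rT; rewrite addrC addKr gtr0_norm.
have T2 : Theta (th + - h) by apply: rT; rewrite addrC addKr normrN gtr0_norm.
have I := integrableD measurableT (dens_mgf_integrable Tt T1) (dens_mgf_integrable Tt T2).
have := integrableZl measurableT h^-1 I; apply: le_integrable => //.
  by apply/measurable_EFinP; exact: measurable_funM.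
move=> x _; rewrite -EFinD -EFinM /= lee_fin -mulrDr mulrCA !normrM ler_wpM2l//.
rewrite (@gtr0_norm _ h^-1) ?invr_gt0// ler_pdivlMl// [leRHS]ger0_norm ?addr_ge0 ?expR_ge0//.
exact: mul_norm_le_expRD.
Qed.

Let m th := fine (\int[rho]_x (dens rho th x * x)%:E)%E.

Lemma dens_integral_lin th a b : Theta th ->
  (\int[rho]_x (dens rho th x * (a * x + b))%:E = (a * m th + b)%:E)%E.
Proof.
move=> Tt; rewrite (eq_integral (fun x : R => (a%:E * (dens rho th x * x)%:E +
    b%:E * (dens rho th x)%:E)%E)); last first.
  by move=> x _; rewrite -!EFinM -EFinD; congr (_)%:E; ring.
have i1 := dens_id_integrable Tt; have i2 := dens_integrable Tt.
rewrite integralD//; last 2 first.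
- exact: integrableZl.
- exact: integrableZl.
rewrite !integralZl// dens_integral1// -[X in (_ * X + _)%E]fineK ?integrable_fin_num//.
by rewrite -EFinM -EFinM -EFinD mulr1.
Qed.

(** Jensen's inequality, obtained by integrating [1 + y <= expR y] at [y = h * (x - m th)] against
    the density. *)
Lemma mgf_ge_lin th h : Theta th -> Theta (th + h) -> h * m th <= B (th + h) - B th.
Proof.
move=> Tt Tth.
suff : 1 <= expR (B (th + h) - B th - h * m th) by rewrite -expR0 ler_expR subr_ge0.
rewrite expRB -lee_fin EFinM -dens_mgf// -expRN muleC.
have ig : rho.-integrable setT (fun x : R => ((expR (- (h * m th)))%:E * (dens rho th x * expR (x * h))%:E)%E).
  by apply: integrableZl => //; exact: dens_mgf_integrable.
rewrite -integralZl//; last exact: dens_mgf_integrable.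
have -> : 1%E = (\int[rho]_x (dens rho th x * (h * x + (1 - h * m th)))%:E)%E.
  by rewrite dens_integral_lin//; congr EFin; ring.
apply: le_integral => //.
  have := integrableD measurableT (integrableZl measurableT h (dens_id_integrable Tt))
    (integrableZl measurableT (1 - h * m th) (dens_integrable Tt)).
  by apply: eq_integrable => // x _; rewrite -!EFinM -EFinD; congr EFin; ring.
move=> x _; rewrite -EFinM lee_fin mulrCA ler_wpM2l ?expR_ge0// -expRD.
by apply: le_trans (expR_ge1Dx _); lra.
Qed.

(* [mgf_ge_lin] says that [B (th + h) - B th - h * m th] is minimal at [h = 0], so its derivative there vanishes. *)
Lemma meanmapE th : Theta th -> meanmap rho th = m th.
Proof.
move=> Tt; have [r r0 rT] := open_interval_nbhs hTheta Tt.
pose f := fun t => B t - m th * t.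
have dl t : derivable (fun t : R => m th * t) t 1 by apply: derivableM.
have df t : Theta t -> derivable f t 1.
  by move=> T; apply: derivableB => //; exact: hder.
have inT t : t \in `]th - r, th + r[%R -> Theta t.
  by rewrite in_itv/= => /andP[a b]; apply: rT; rewrite ltr_norml; apply/andP; split; lra.
have ff : is_derive th (1 : R) f 0.
  apply: (@derive1_at_min _ _ (th - r) (th + r)).
  - by lra.
  - by move=> t /inT; exact: df.
  - by rewrite in_itv/=; apply/andP; split; lra.
  - move=> t /inT Tt'; rewrite /f.
    have := @mgf_ge_lin th (t - th) Tt; rewrite addrC subrK => /(_ Tt').
    by move: (B t) (B th) (m th) => b c u; lra.
have := @derive_val _ _ _ _ _ _ _ ff.
rewrite /f deriveB//; last exact: hder.
rewrite /meanmap derive1E => /eqP; rewrite subr_eq0 => /eqP ->.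
by rewrite deriveM// derive_cst derive_id scaler0 addr0 /GRing.scale/= mulr1.
Qed.

Lemma bfun_tangent th th' : Theta th -> Theta th' ->
  meanmap rho th * (th' - th) <= B th' - B th.
Proof.
move=> Tt Tt'; rewrite meanmapE// mulrC.
by have := @mgf_ge_lin th (th' - th) Tt; rewrite addrC subrK; apply.
Qed.

Lemma klE th th' : Theta th -> Theta th' ->
  kl rho th th' = (B th' - B th - meanmap rho th * (th' - th))%:E.
Proof.
move=> Tt Tt'; rewrite meanmapE//.
have E (x : R) : x * (th - th') - B th + B th' = (th - th') * x + (B th' - B th).
  by move: (B th) (B th') => b c; ring.
rewrite /kl (eq_integral (fun x : R => (dens rho th x * ((th - th') * x + (B th' - B th)))%:E)).
  rewrite dens_integral_lin//; move: (B th) (B th') (m th) => b c u.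
  by congr EFin; ring.
by move=> x _; rewrite E.
Qed.


Hypothesis hinj : {in Theta &, injective (meanmap rho)}.
Hypothesis hM : is_open_interval (Mset rho Theta).

(** The tangent inequalities at the two points add up to monotonicity, and injectivity makes it
    strict. *)
Lemma meanmap_lt th th' : Theta th -> Theta th' -> th < th' ->
  meanmap rho th < meanmap rho th'.
Proof.
move=> Tt Tt' tt'; rewrite lt_neqAle; apply/andP; split.
  apply/eqP => /hinj e; move: tt'; rewrite e ?ltxx//; exact: mem_set.
have h1 := bfun_tangent Tt Tt'; have h2 := bfun_tangent Tt' Tt.
have d0 : 0 < th' - th by rewrite subr_gt0.
rewrite -(ler_pM2r d0); move: h1 h2.
by move: (B th) (B th') (meanmap rho th) (meanmap rho th') => b c u v; lra.
Qed.

Local Notation theta := (theta_of rho Theta).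
Local Notation M := (Mset rho Theta).

Lemma theta_ofP y0 : M y0 -> Theta (theta y0) /\ meanmap rho (theta y0) = y0.
Proof. by move=> [th Tt e]; apply: (@xgetPex _ 0 [set th | Theta th /\ meanmap rho th = y0]); exists th. Qed.

Lemma theta_of_lt y0 y0' : M y0 -> M y0' -> y0 < y0' -> theta y0 < theta y0'.
Proof.
move=> Mm Mm' mm'; have [T1 e1] := theta_ofP Mm; have [T2 e2] := theta_ofP Mm'.
rewrite ltNge le_eqVlt; apply/negP => /orP[/eqP e|/(meanmap_lt T2 T1)].
  by move: mm'; rewrite -e1 -e2 e ltxx.
by rewrite e1 e2 => /ltW; rewrite leNgt mm'.
Qed.

Lemma theta_of_continuous y0 e : M y0 -> 0 < e -> exists2 r : R, 0 < r & forall y, `|y - y0| < r ->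
  [/\ M y, `|theta y - theta y0| < e & `|B (theta y) - B (theta y0)| < e].
Proof.
move=> My0 e0; apply: (increasing_section_continuous hTheta hM) => //.
- by move=> th Tt; exists th.
- exact: theta_ofP.
- exact: meanmap_lt.
- move=> th Tt; apply: differentiable_continuous; apply/derivable1_diffP; exact: hder.
Qed.

Lemma dKLE x y : M x -> M y ->
  dKL rho Theta x y = (B (theta y) - B (theta x) - x * (theta y - theta x))%:E.
Proof.
by move=> /theta_ofP[T1 e1] /theta_ofP[T2 e2]; rewrite /dKL klE// e1.
Qed.

End expfam.

(** * Bregman divergences *)

Section bregman.
Context {R : realType} (M : set R) (th psi : R -> R).

(** With [th] the natural parameter and [psi] the log-partition function, both read as functions of
    the mean, this is the Kullback-Leibler divergence from mean [x] to mean [y]. *)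
Definition breg (x y : R) : R := psi y - psi x - x * (th y - th x).

(** The minimum over [y] of [a * breg p y + c * breg q y]. With [a], [c] weights it is the cost of
    confusing two arms; with pull counts it is the statistic of Stage III. *)
Definition breg_mix (a c p q : R) : R :=
  let x := (a * p + c * q) / (a + c) in a * breg p x + c * breg q x.

(** The properties through which the analysis of the characteristic time and of a run sees the
    exponential family. *)
Record bregman_family : Prop := BregmanFamily {
  bregman_between : forall x y z : R, M x -> M z -> x <= y <= z -> M y;
  bregman_lt : forall x y : R, M x -> M y -> x < y -> th x < th y;
  bregman_ge0 : forall x y : R, M x -> M y -> 0 <= breg x y;
  bregman_cont : forall m (e : R), M m -> 0 < e -> exists2 r : R, 0 < r & forall y,
    `|y - m| < r -> [/\ M y, `|th y - th m| < e & `|psi y - psi m| < e] }.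

Hypothesis H : bregman_family.
Let Mbetween := bregman_between H.
Let th_lt := bregman_lt H.
Let breg_ge0 := bregman_ge0 H.
Let th_psi_cont := bregman_cont H.

Lemma th_le x y : M x -> M y -> x <= y -> th x <= th y.
Proof. by move=> Mx My; rewrite le_eqVlt => /orP[/eqP->//|/(th_lt Mx My)/ltW]. Qed.

Lemma breg_xx x : breg x x = 0.
Proof. by rewrite /breg; ring. Qed.

(** Three-point identity; monotonicity on either side of [x] is read off the sign of its last
    term. *)
Lemma breg_three x y z : breg x z = breg x y + breg y z + (y - x) * (th z - th y).
Proof. by rewrite /breg; ring. Qed.

Lemma breg_mono_right x y z : M x -> M y -> M z -> x <= y -> y <= z -> breg x y <= breg x z.
Proof.
move=> Mx My Mz xy yz; rewrite (breg_three x y z) -addrA lerDl addr_ge0 ?breg_ge0//.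
by rewrite mulr_ge0// subr_ge0// th_le.
Qed.

Lemma breg_mono_left x y z : M x -> M y -> M z -> y <= x -> z <= y -> breg x y <= breg x z.
Proof.
move=> Mx My Mz xy yz; rewrite (breg_three x y z) -addrA lerDl addr_ge0 ?breg_ge0//.
by rewrite mulr_le0// subr_le0// th_le.
Qed.

(** The last term of the three-point identity at the midpoint is positive, since [th] is strictly
    increasing. *)
Lemma breg_gt0 x y : M x -> M y -> x != y -> 0 < breg x y.
Proof.
move=> Mx My xy; pose z := (x + y) / 2.
have [h|h] := ltP x y.
  have Mz : M z by apply: (Mbetween Mx My); rewrite /z; apply/andP; split; lra.
  rewrite (breg_three x z y); apply: ltr_wpDl; first by rewrite addr_ge0 ?breg_ge0.
  rewrite mulr_gt0//.
    by rewrite /z; lra.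
  by rewrite subr_gt0 th_lt// /z; lra.
have {xy}h : y < x by rewrite lt_neqAle h eq_sym xy.
have Mz : M z by apply: (Mbetween My Mx); rewrite /z; apply/andP; split; lra.
rewrite (breg_three x z y); apply: ltr_wpDl; first by rewrite addr_ge0 ?breg_ge0.
rewrite -mulrNN mulr_gt0//.
  by rewrite /z; lra.
by rewrite oppr_gt0 subr_lt0 th_lt// /z; lra.
Qed.

(** As functions of [y], the two sums of divergences differ by a constant, because [y] enters only
    through [psi y] and [th y], with coefficients the total weight and the weighted sum of the
    means. *)
Lemma breg_mix_compensation (a c p q y : R) : a + c != 0 ->
  a * breg p y + c * breg q y =
  breg_mix a c p q + (a + c) * breg ((a * p + c * q) / (a + c)) y.
Proof. by move=> ac; rewrite /breg_mix /breg; field. Qed.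

Lemma mix_mean_between (a c p q : R) : 0 <= a -> 0 <= c -> 0 < a + c -> q <= p ->
  q <= (a * p + c * q) / (a + c) <= p.
Proof.
move=> a0 c0 ac qp; rewrite ler_pdivlMr// ler_pdivrMr//.
have h1 : 0 <= a * (p - q) by rewrite mulr_ge0// subr_ge0.
have h2 : 0 <= c * (p - q) by rewrite mulr_ge0// subr_ge0.
by apply/andP; split; lra.
Qed.

Lemma breg_mix_le (a c p q y : R) : 0 <= a -> 0 <= c -> M p -> M q -> M y -> q <= p ->
  breg_mix a c p q <= a * breg p y + c * breg q y.
Proof.
move=> a0 c0 Mp Mq My qp.
have := addr_ge0 a0 c0; rewrite le_eqVlt => /orP[/eqP ac|ac].
  have [-> ->] : a = 0 /\ c = 0 by lra.
  by rewrite /breg_mix !mul0r.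
rewrite breg_mix_compensation ?gt_eqF// lerDl mulr_ge0 ?(ltW ac)//.
by apply: breg_ge0 => //; apply: (Mbetween Mq Mp); exact: mix_mean_between.
Qed.

Lemma breg_mix_attained (a c p q : R) : 0 <= a -> 0 <= c -> q <= p ->
  exists2 y : R, q <= y <= p & breg_mix a c p q = a * breg p y + c * breg q y.
Proof.
move=> a0 c0 qp; have := addr_ge0 a0 c0; rewrite le_eqVlt => /orP[/eqP ac|ac].
  (* With both weights zero the quotient is the default [0], possibly outside [[q, p]]; any point
     then gives the value [0]. *)
  exists p; first by rewrite qp lexx.
  have [-> ->] : a = 0 /\ c = 0 by lra.
  by rewrite /breg_mix !mul0r.
by exists ((a * p + c * q) / (a + c)) => //; exact: mix_mean_between.
Qed.

Lemma breg_mix_ge0 a c p q : 0 <= a -> 0 <= c -> M p -> M q -> q <= p -> 0 <= breg_mix a c p q.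
Proof.
move=> a0 c0 Mp Mq qp; have [y yb ->] := breg_mix_attained a0 c0 qp.
have My := Mbetween Mq Mp yb.
by rewrite addr_ge0// mulr_ge0// breg_ge0.
Qed.

(** A minimum of functions linear in the weights: the minimizer for [(a', c')] is tested with
    [(a, c)]. It lies between [q] and [p], so the slopes are at most [breg p q] and [breg q p]. *)
Lemma breg_mix_Lipschitz a c a' c' p q : 0 <= a -> 0 <= c -> 0 <= a' -> 0 <= c' ->
  M p -> M q -> q <= p ->
  breg_mix a c p q <= breg_mix a' c' p q + `|a - a'| * breg p q + `|c - c'| * breg q p.
Proof.
move=> a0 c0 a'0 c'0 Mp Mq qp; have [y yb e] := breg_mix_attained a'0 c'0 qp.
have My := Mbetween Mq Mp yb; move/andP: yb => [qy yp].
apply: (le_trans (breg_mix_le a0 c0 Mp Mq My qp)); rewrite e.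
have h1 : (a - a') * breg p y <= `|a - a'| * breg p q.
  apply: (le_trans (ler_norm _)); rewrite normrM ler_wpM2l// ger0_norm ?breg_ge0//.
  exact: breg_mono_left.
have h2 : (c - c') * breg q y <= `|c - c'| * breg q p.
  apply: (le_trans (ler_norm _)); rewrite normrM ler_wpM2l// ger0_norm ?breg_ge0//.
  exact: breg_mono_right.
lra.
Qed.

Lemma breg_mix_concave (a c a' c' p q : R) : 0 <= a -> 0 <= c -> 0 <= a' -> 0 <= c' ->
  M p -> M q -> q <= p ->
  (breg_mix a c p q + breg_mix a' c' p q) / 2 <= breg_mix ((a + a') / 2) ((c + c') / 2) p q.
Proof.
move=> a0 c0 a'0 c'0 Mp Mq qp.
have A0 : 0 <= (a + a') / 2 by rewrite divr_ge0// addr_ge0.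
have C0 : 0 <= (c + c') / 2 by rewrite divr_ge0// addr_ge0.
have [y yb ->] := breg_mix_attained A0 C0 qp.
have My := Mbetween Mq Mp yb.
have h1 := breg_mix_le a0 c0 Mp Mq My qp; have h2 := breg_mix_le a'0 c'0 Mp Mq My qp.
lra.
Qed.

Lemma breg_mix_scale s a c p q : s != 0 -> breg_mix (s * a) (s * c) p q = s * breg_mix a c p q.
Proof.
by move=> s0; rewrite /breg_mix -!mulrA -!mulrDr invfM mulrACA divff// mul1r.
Qed.

Lemma breg_mix_mono a c a' c' p q : 0 <= a -> 0 <= c -> a <= a' -> c <= c' ->
  M p -> M q -> q <= p -> breg_mix a c p q <= breg_mix a' c' p q.
Proof.
move=> a0 c0 aa cc Mp Mq qp.
have [y yb ->] := breg_mix_attained (le_trans a0 aa) (le_trans c0 cc) qp.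
have My := Mbetween Mq Mp yb.
by apply: (le_trans (breg_mix_le a0 c0 Mp Mq My qp)); rewrite lerD// ler_wpM2r// breg_ge0.
Qed.

Lemma breg_mix_lt_left a a' c p q : 0 <= a -> a < a' -> 0 < c ->
  M p -> M q -> q < p -> breg_mix a c p q < breg_mix a' c p q.
Proof.
move=> a0 aa c0 Mp Mq qp; have a'0 := le_lt_trans a0 aa.
set x := (a' * p + c * q) / (a' + c).
have ac : 0 < a' + c by rewrite addr_gt0.
have /andP[qx xp] : q <= x <= p by apply: mix_mean_between; rewrite ?ltW.
have xp' : x < p.
  rewrite ltr_pdivrMr//; have : 0 < c * (p - q) by rewrite mulr_gt0// subr_gt0.
  lra.
have Mx : M x by apply: (Mbetween Mq Mp); rewrite qx.
apply: (le_lt_trans (breg_mix_le a0 (ltW c0) Mp Mq Mx (ltW qp))).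
rewrite /breg_mix -/x ltrD2r ltr_pM2r// breg_gt0// gt_eqF//.
Qed.

Lemma breg_mix_gt0 a c p q : 0 < a -> 0 < c -> M p -> M q -> q < p -> 0 < breg_mix a c p q.
Proof.
move=> a0 c0 Mp Mq qp.
exact: le_lt_trans (breg_mix_ge0 (lexx 0) (ltW c0) Mp Mq (ltW qp)) (breg_mix_lt_left (lexx 0) a0 c0 Mp Mq qp).
Qed.

Lemma breg_mix0l c p q : breg_mix 0 c p q = 0.
Proof.
rewrite /breg_mix !mul0r !add0r; have [->|c0] := eqVneq c 0; first by rewrite mul0r.
by rewrite mulrAC divff// mul1r breg_xx mulr0.
Qed.

Lemma breg_mix0r a p q : breg_mix a 0 p q = 0.
Proof.
rewrite /breg_mix !mul0r !addr0; have [->|c0] := eqVneq a 0; first by rewrite mul0r.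
by rewrite mulrAC divff// mul1r breg_xx mulr0.
Qed.

(* The minimising points of the two summands coincide in the equality case. *)
Lemma breg_mix_midpoint a c a' c' p q : 0 < a -> 0 <= c -> 0 < a' -> 0 <= c' ->
  M p -> M q -> q < p ->
  breg_mix ((a + a') / 2) ((c + c') / 2) p q <= (breg_mix a c p q + breg_mix a' c' p q) / 2 ->
  a * c' = a' * c.
Proof.
move=> a0 c0 a'0 c'0 Mp Mq qp.
set A := (a + a') / 2; set C := (c + c') / 2; set x := (A * p + C * q) / (A + C).
have A0 : 0 < A by rewrite divr_gt0// addr_gt0.
have C0 : 0 <= C by rewrite divr_ge0// addr_ge0.
have AC : 0 < A + C by rewrite ltr_wpDr.
have Mx : M x.
  by apply: (Mbetween Mq Mp); exact: (mix_mean_between (ltW A0) C0 AC (ltW qp)).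
have E1 := @breg_mix_compensation a c p q x; have E2 := @breg_mix_compensation a' c' p q x.
have ac : 0 < a + c by rewrite ltr_wpDr.
have ac' : 0 < a' + c' by rewrite ltr_wpDr.
rewrite !gt_eqF// in E1 E2; move: (E1 isT) (E2 isT) => {}E1 {}E2.
have E0 : breg_mix A C p q = A * breg p x + C * breg q x by [].
set y := (a * p + c * q) / (a + c) in E1; set y' := (a' * p + c' * q) / (a' + c') in E2.
have My : M y.
  by apply: (Mbetween Mq Mp); exact: (mix_mean_between (ltW a0) c0 ac (ltW qp)).
have My' : M y'.
  by apply: (Mbetween Mq Mp); exact: (mix_mean_between (ltW a'0) c'0 ac' (ltW qp)).
have E3 : A * breg p x + C * breg q x =
   ((a * breg p x + c * breg q x) + (a' * breg p x + c' * breg q x)) / 2.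
  by rewrite /A /C; field.
rewrite E0 E3 E1 E2 => h.
have z1 : 0 <= (a + c) * breg y x by rewrite mulr_ge0 ?breg_ge0//; exact: ltW.
have z2 : 0 <= (a' + c') * breg y' x by rewrite mulr_ge0 ?breg_ge0//; exact: ltW.
have {}z1 : (a + c) * breg y x = 0 by lra.
have {}z2 : (a' + c') * breg y' x = 0 by lra.
have eyx : y = x.
  apply/eqP; apply: contraT => /(breg_gt0 My Mx) k; have := mulr_gt0 ac k; lra.
have eyx' : y' = x.
  apply/eqP; apply: contraT => /(breg_gt0 My' Mx) k; have := mulr_gt0 ac' k; lra.
have : y = y' by rewrite eyx eyx'.
have [n1 n2] : a + c != 0 /\ a' + c' != 0 by rewrite !gt_eqF.
move/eqP; rewrite /y /y' eqr_div// -subr_eq0.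
have -> : (a * p + c * q) * (a' + c') - (a' * p + c' * q) * (a + c) = (a * c' - a' * c) * (p - q) by ring.
by rewrite mulf_eq0 !subr_eq0 (gt_eqF qp) orbF => /eqP.
Qed.

(** Uniformity in [y] is the point, as the minimizing [y] varies with the weights. In the difference
    [y] occurs only through [th y], so a bound on [th y] suffices. *)
Lemma breg_cont_left (p0 K e : R) : M p0 -> 0 < e -> exists2 r : R, 0 < r & forall p, `|p - p0| < r ->
  M p /\ forall y, `|th y| <= K -> `|breg p y - breg p0 y| <= e.
Proof.
move=> Mp0 e0.
pose C := 1 + `|p0| + 1 + `|th p0| + `|K|.
have C0 : 0 < C by rewrite /C; have := normr_ge0 p0; have := normr_ge0 (th p0); have := normr_ge0 K; lra.
have eC : 0 < e / C / 2 by rewrite !divr_gt0.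
have [r r0 Hr] := th_psi_cont Mp0 eC.
exists (Num.min (Num.min r (e / C / 2)) 1) => [|p]; first by rewrite !lt_min r0 eC ltr01.
rewrite !lt_min => /andP[/andP[pr pe] p1]; have [Mp h1 h2] := Hr p pr.
split=> // y yK.
have -> : breg p y - breg p0 y =
  - (psi p - psi p0) + p * (th p - th p0) + (p - p0) * (th p0 - th y).
  by rewrite /breg; ring.
have np : `|p| <= `|p0| + 1.
  have -> : p = p0 + (p - p0) by ring.
  by apply: (le_trans (ler_normD _ _)); rewrite lerD2l ltW.
apply: (le_trans (ler_normD _ _)); rewrite (le_trans (lerD (ler_normD _ _) (lexx _)))// !normrM normrN.
have k1 : `|p| * `|th p - th p0| <= (`|p0| + 1) * (e / C / 2) by rewrite ler_pM// ltW.
have k2 : `|p - p0| * `|th p0 - th y| <= (e / C / 2) * (`|th p0| + `|K|).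
  rewrite ler_pM// ?(ltW pe)//; apply: (le_trans (ler_normB _ _)); rewrite lerD2l.
  exact: le_trans (ler_norm K).
apply: (@le_trans _ _ ((e / C / 2) * C)); first by rewrite /C in k1 k2 h2 *; lra.
have -> : e / C / 2 * C = e / 2 by field; rewrite gt_eqF.
lra.
Qed.

Lemma breg_cont_right (q y e : R) : M y -> 0 < e -> exists2 r : R, 0 < r & forall y', `|y' - y| < r ->
  M y' /\ `|breg q y' - breg q y| <= e.
Proof.
move=> My e0; have C0 : 0 < 1 + `|q| by have := normr_ge0 q; lra.
have [r r0 Hr] := th_psi_cont My (divr_gt0 e0 C0).
exists r => // y' /Hr [My' h1 h2]; split=> //.
have -> : breg q y' - breg q y = (psi y' - psi y) - q * (th y' - th y) by rewrite /breg; ring.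
apply: (le_trans (ler_normB _ _)); rewrite normrM.
have k : `|q| * `|th y' - th y| <= `|q| * (e / (1 + `|q|)) by rewrite ler_wpM2l// ltW.
have -> : e = e / (1 + `|q|) + `|q| * (e / (1 + `|q|)) by field; rewrite gt_eqF.
by rewrite lerD// ltW.
Qed.

(** Replacing both [x] and [z] by the projection of [x] onto [[q, p]] increases neither divergence,
    so swapping the order of two arms costs at least as much as merging them. *)
Lemma breg_mix_le_alt (a c p q x z : R) : 0 <= a -> 0 <= c -> M p -> M q -> M x -> M z ->
  q <= p -> x < z -> breg_mix a c p q <= a * breg p x + c * breg q z.
Proof.
move=> a0 c0 Mp Mq Mx Mz qp xz.
have key y : M y -> breg p y <= breg p x -> breg q y <= breg q z ->
    breg_mix a c p q <= a * breg p x + c * breg q z.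
  move=> My h1 h2; apply: (le_trans (breg_mix_le a0 c0 Mp Mq My qp)).
  by rewrite lerD// ler_wpM2l.
have [px|xp] := leP p x.
  apply: (key p) => //; first by rewrite breg_xx breg_ge0.
  by apply: breg_mono_right => //; exact: le_trans px (ltW xz).
have [qx|xq] := leP q x.
  by apply: (key x) => //; apply: breg_mono_right => //; exact: ltW.
apply: (key q) => //; last by rewrite breg_xx breg_ge0.
by apply: breg_mono_left => //; exact: ltW.
Qed.

End bregman.

(** * Characteristic time *)

Section simplex_compact.
Context {R : realType} (n : nat).
Implicit Types (u v : 'rV[R]_n) (w : {ffun 'I_n -> R}).

Lemma coord_le_norm v i : `|v ord0 i| <= `|v|.
Proof. by rewrite [leRHS]/Num.Def.normr /= mx_normrE; apply/bigmax_geP; right; exists (ord0, i). Qed.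

Lemma Lipschitz_rV_continuous (f : 'rV[R]_n -> R) C :
  (forall u v, `|f u - f v| <= C * \sum_i `|u ord0 i - v ord0 i|) -> continuous f.
Proof.
move=> L v A /nbhs_ballP[e /= e0 eA].
pose D := (`|C| + 1) * (n%:R + 1).
have D0 : 0 < D by rewrite mulr_gt0// ltr_pwDr//.
apply/nbhs_ballP; exists (e / D) => [|u]; first exact: divr_gt0.
rewrite -ball_normE /= => vu; apply: eA; rewrite /ball /=; apply: (le_lt_trans (L _ _)).
have S : \sum_i `|v ord0 i - u ord0 i| <= n%:R * `|v - u|.
  rewrite -[n in n%:R]card_ord -sum1_card natr_sum mulr_suml; apply: ler_sum => i _.
  by rewrite mul1r; apply: le_trans (coord_le_norm (v - u) i); rewrite !mxE.
have S0 : 0 <= \sum_i `|v ord0 i - u ord0 i| by exact: sumr_ge0.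
apply: (@le_lt_trans _ _ (D * `|v - u|)); last by rewrite mulrC -ltr_pdivlMr.
apply: (@le_trans _ _ (`|C| * \sum_i `|v ord0 i - u ord0 i|)).
  by rewrite ler_wpM2r// ler_norm.
rewrite /D -mulrA ler_pM// ?lerDl//.
by apply: (le_trans S); rewrite ler_wpM2r// lerDl.
Qed.

(** The constraint on coordinate [i0] keeps the weights away from a given value; it is used to
    separate the maximum from its neighbours, and [z0 = 0] gives the maximum over the whole
    simplex. *)
Lemma simplex_exists_max (f : {ffun 'I_n -> R} -> R) K i0 (x0 z0 : R) :
  (forall w w', (forall i, 0 <= w i) -> (forall i, 0 <= w' i) ->
     f w <= f w' + K * \sum_i `|w i - w' i|) ->
  (exists w, simplex w /\ z0 <= `|w i0 - x0|) ->
  exists w, [/\ simplex w, z0 <= `|w i0 - x0| &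
    forall w', simplex w' -> z0 <= `|w' i0 - x0| -> f w' <= f w].
Proof.
move=> L [w1 [sw1 zw1]].
pose toff (v : 'rV[R]_n) : {ffun 'I_n -> R} := [ffun i => v ord0 i].
(* The Lipschitz bound covers non-negative weights; absolute values extend [f] continuously to the
   whole space and change nothing on [A]. *)
pose toffa (v : 'rV[R]_n) : {ffun 'I_n -> R} := [ffun i => `|v ord0 i|].
pose A := [set v : 'rV[R]_n | simplex (toff v) /\ z0 <= `|v ord0 i0 - x0|].
have toffK w : toff (\row_i w i) = w by apply/ffunP => i; rewrite ffunE mxE.
have toffaE v : A v -> toffa v = toff v.
  by move=> [[h _] _]; apply/ffunP => i; rewrite !ffunE ger0_norm//; have := h i; rewrite ffunE.
have cA : compact A.
  apply: bounded_closed_compact.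
    exists 1; split => // x x1 v [[h0 h1] _]; apply: le_trans (ltW x1).
    rewrite [leLHS]/Num.Def.normr /= mx_normrE; apply/bigmax_leP; split => // -[a b] _ /=.
    rewrite (ord1 a); have := h0 b; rewrite ffunE => vb; rewrite ger0_norm//.
    rewrite -h1 (bigD1 b)//= ffunE lerDl sumr_ge0// => j _; exact: h0.
  have -> : A = (\bigcap_(i in [set: 'I_n]) ((fun v => v ord0 i) @^-1` [set x | 0 <= x])) `&`
    ((fun v : 'rV[R]_n => \sum_i v ord0 i) @^-1` [set x | x = 1] `&`
     (fun v : 'rV[R]_n => `|v ord0 i0 - x0|) @^-1` [set x | z0 <= x]).
    apply/seteqP; split=> v /=.
      move=> [[h0 h1] h2]; split; first by move=> i _; have := h0 i; rewrite ffunE.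
      by split=> //; rewrite -h1; apply: eq_bigr => i _; rewrite ffunE.
    move=> [h0 [h1 h2]]; split=> //; split=> [i|]; first by rewrite ffunE; exact: h0.
    by rewrite -h1; apply: eq_bigr => i _; rewrite ffunE.
  apply: closedI; [apply: closed_bigI => i _|apply: closedI]; apply: preimage_closed.
  - move=> v _; exact: coord_continuous.
  - exact: closed_ge.
  - move=> v _; apply: (@Lipschitz_rV_continuous _ 1) => a b.
    by rewrite mul1r -sumrB; exact: ler_norm_sum.
  - exact: closed_eq.
  - move=> v _; apply: (@Lipschitz_rV_continuous _ 1) => a b; rewrite mul1r.
    apply: (le_trans (ler_dist_dist _ _)).
    have -> : a ord0 i0 - x0 - (b ord0 i0 - x0) = a ord0 i0 - b ord0 i0 by ring.
    by rewrite (bigD1 i0)//= lerDl sumr_ge0.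
  - exact: closed_ge.
have cf : {within A, continuous (f \o toffa)}.
  apply: continuous_subspaceT; apply: (@Lipschitz_rV_continuous _ `|K|) => u v.
  have P0 t i : 0 <= toffa t i by rewrite ffunE.
  have S t t' : K * \sum_i `|toffa t i - toffa t' i| <= `|K| * \sum_i `|t ord0 i - t' ord0 i|.
    apply: (le_trans (ler_norm _)); rewrite normrM ler_wpM2l// ger0_norm ?sumr_ge0//.
    by apply: ler_sum => i _; rewrite !ffunE; exact: ler_dist_dist.
  have h1 := L _ _ (P0 u) (P0 v); have h2 := L _ _ (P0 v) (P0 u).
  have k1 := S u v; have := S v u.
  have -> : \sum_i `|v ord0 i - u ord0 i| = \sum_i `|u ord0 i - v ord0 i|.
    by apply: eq_bigr => i _; rewrite distrC.
  move=> k2; rewrite ler_norml /=; apply/andP; split; lra.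
have A0 : A !=set0 by exists (\row_i w1 i); split; rewrite ?toffK// mxE.
have [v /set_mem Av vmax] := EVT_max_rV A0 cA cf.
exists (toff v); split; [exact: Av.1|by rewrite ffunE; exact: Av.2|].
move=> w' sw' zw'; have Aw' : A (\row_i w' i) by split; rewrite ?toffK// mxE.
have := vmax _ (mem_set Aw'); rewrite /= !toffaE// toffK //.
Qed.

Lemma ex_pos_forall (P : 'I_n -> R -> Prop) :
  (forall i r r', P i r -> 0 < r' -> r' <= r -> P i r') ->
  (forall i, exists2 r, 0 < r & P i r) -> exists2 r, 0 < r & forall i, P i r.
Proof.
move=> mono ex; have [g gP] : {g : 'I_n -> R & forall i, 0 < g i /\ P i (g i)}.
  by apply: (@choice _ _ (fun i r => 0 < r /\ P i r)) => i; have [r] := ex i; exists r.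
have g0 : 0 < \big[Num.min/1]_i g i by apply: lt_bigmin => // i _; exact: (gP i).1.
exists (\big[Num.min/1]_i g i) => // i; apply: mono (gP i).2 g0 _; exact: bigmin_le.
Qed.

End simplex_compact.

Section chartime.
Context {R : realType} (rho : {measure set R -> \bar R}) (Theta : set R) (th psi : R -> R).
Local Notation M := (Mset rho Theta).
Hypothesis H : bregman_family M th psi.
Hypothesis dE : forall x y, M x -> M y -> dKL rho Theta x y = (breg th psi x y)%:E.
Variable n : nat.
Hypothesis hn : (2 <= n)%N.
Implicit Types (lam : 'I_n -> R) (k j : 'I_n) (w : {ffun 'I_n -> R}).

Local Notation mix := (breg_mix th psi).
Local Notation obj := (objective rho Theta).

Definition unique_max lam k := forall j, j != k -> lam j < lam k.

Lemma ex_other k : exists j, j != k.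
Proof.
have h0 : (0 < n)%N by exact: leq_trans hn.
have [->|h] := eqVneq k (Ordinal h0); first by exists (Ordinal hn).
by exists (Ordinal h0); rewrite eq_sym.
Qed.

Lemma ge_sum2 (f : 'I_n -> R) k j : j != k -> (forall i, 0 <= f i) -> f k + f j <= \sum_i f i.
Proof.
move=> jk f0; rewrite (bigD1 k)//= lerD2l (bigD1 j)//= lerDl.
by apply: sumr_ge0.
Qed.

Lemma simplex_ge0 w : simplex w -> forall i, 0 <= w i.
Proof. by case. Qed.

Lemma simplex_le1 w k j : simplex w -> j != k -> w k + w j <= 1.
Proof. by move=> [w0 w1] jk; rewrite -w1; exact: ge_sum2. Qed.

Section fixed_instance.
Variables (lam : 'I_n -> R) (k : 'I_n).
Hypothesis lamM : forall i, M (lam i).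
Hypothesis lamk : unique_max lam k.

(** The inequality in [Alt] is strict, so a common mean for two arms is only a limit of
    alternatives. Comparing lower bounds rather than values absorbs this limit. *)
Lemma objective_geP w v : (forall i, 0 <= w i) ->
  (v%:E <= obj lam k w)%E <-> forall j, j != k -> v <= mix (w k) (w j) (lam k) (lam j).
Proof.
move=> w0.
have sumE lam' : (forall i, M (lam' i)) ->
    (\sum_(i < n) (w i)%:E * dKL rho Theta (lam i) (lam' i) =
     (\sum_i w i * breg th psi (lam i) (lam' i))%:E)%E.
  by move=> Ml; rewrite -sumEFin; apply: eq_bigr => i _; rewrite dE// EFinM.
split=> [/ereal_infP vle j jk|vle]; last first.
  apply/ereal_infP => _ [lam' [Ml [j [jk lt_kj]]] <-].
  rewrite sumE// lee_fin; apply: (le_trans (vle j jk)).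
  apply: le_trans (breg_mix_le_alt H (w0 k) (w0 j) (lamM k) (lamM j) (Ml k) (Ml j) (ltW (lamk jk)) lt_kj) _.
  apply: (@ge_sum2 (fun i => w i * breg th psi (lam i) (lam' i))) => // i.
  by rewrite mulr_ge0// (bregman_ge0 H).
apply/ler_addgt0Pr => e e0.
have [y yb ->] := breg_mix_attained th psi (w0 k) (w0 j) (ltW (lamk jk)).
have My := bregman_between H (lamM j) (lamM k) yb.
(* Dividing by [w j + 1] is safe when [w j] vanishes, and multiplying by [w j] afterwards leaves at
   most [e]. *)
have wj1 : 0 < w j + 1 by have := w0 j; lra.
have [r r0 Hr] := breg_cont_right H (lam j) My (divr_gt0 e0 wj1).
have [My' hy'] : M (y + r / 2) /\ `|breg th psi (lam j) (y + r / 2) - breg th psi (lam j) y| <= e / (w j + 1).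
  by apply: Hr; rewrite addrC addKr gtr0_norm ?divr_gt0//; lra.
(* Arm [k] is moved to the minimizing mean and arm [j] slightly above it, as [Alt] demands; the
   other arms cost nothing. *)
pose lam' := fun i => if i == k then y else if i == j then y + r / 2 else lam i.
have Ml i : M (lam' i) by rewrite /lam'; do 2 case: ifP => // _.
have h : v <= \sum_i w i * breg th psi (lam i) (lam' i).
  rewrite -lee_fin -(sumE _ Ml); apply: vle; exists lam' => //.
  by split=> //; exists j; split=> //; rewrite /lam' eqxx (negbTE jk) eqxx ltrDl divr_gt0.
apply: (le_trans h) => {h vle sumE}.
rewrite (bigD1 k)//= (bigD1 j)//= big1 ?addr0; last first.
  by move=> i /andP[ik ij]; rewrite /lam' (negbTE ik) (negbTE ij) breg_xx mulr0.
rewrite /lam' eqxx (negbTE jk) eqxx -addrA lerD2l.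
have : breg th psi (lam j) (y + r / 2) <= breg th psi (lam j) y + e / (w j + 1).
  by have := le_trans (ler_norm _) hy'; rewrite lerBlDl addrC.
move/(ler_wpM2l (w0 j)) => h'; apply: (le_trans h').
rewrite mulrDr lerD2l mulrCA ler_piMr ?(ltW e0)// ler_pdivrMr// mul1r lerDl //.
Qed.

Definition objr w : R := fine (obj lam k w).

Lemma objectiveE w : (forall i, 0 <= w i) -> obj lam k w = (objr w)%:E.
Proof.
move=> w0; rewrite /objr fineK//.
have ge0 : (0%:E <= obj lam k w)%E.
  by apply/(objective_geP _ w0) => j jk; apply: (breg_mix_ge0 H) => //; exact/ltW/lamk.
have [j jk] := ex_other k.
rewrite ge0_fin_numE// lt_neqAle leey andbT; apply/eqP => e.
have := (objective_geP (mix (w k) (w j) (lam k) (lam j) + 1) w0).1.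
by rewrite e leey => /(_ isT j jk); lra.
Qed.

Lemma objr_geP w v : (forall i, 0 <= w i) ->
  v <= objr w <-> forall j, j != k -> v <= mix (w k) (w j) (lam k) (lam j).
Proof. by move=> w0; rewrite -objective_geP// objectiveE// lee_fin. Qed.

Lemma objr_le w j : (forall i, 0 <= w i) -> j != k -> objr w <= mix (w k) (w j) (lam k) (lam j).
Proof. by move=> w0; apply: (objr_geP _ w0).1. Qed.

Lemma objr_attained w : (forall i, 0 <= w i) ->
  exists2 j, j != k & objr w = mix (w k) (w j) (lam k) (lam j).
Proof.
move=> w0; have [j0 j0k] := ex_other k.
case: (@arg_minP _ _ _ j0 (fun j => j != k) (fun j => mix (w k) (w j) (lam k) (lam j)) j0k) => j jk jmin.
exists j => //; apply/eqP; rewrite eq_le objr_le//=.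
by apply/(objr_geP _ w0) => i ik; exact: jmin.
Qed.

Lemma objr_Lipschitz : exists K, forall w w', (forall i, 0 <= w i) -> (forall i, 0 <= w' i) ->
  objr w <= objr w' + K * \sum_i `|w i - w' i|.
Proof.
pose K := \sum_i \sum_j breg th psi (lam i) (lam j).
have b0 i j : 0 <= breg th psi (lam i) (lam j) by rewrite (bregman_ge0 H).
have bK i j : breg th psi (lam i) (lam j) <= K.
  rewrite /K (bigD1 i)//= (bigD1 j)//= -addrA lerDl addr_ge0 ?sumr_ge0// => i' _.
  by rewrite sumr_ge0.
exists K => w w' w0 w'0; rewrite -lerBlDr; apply/(objr_geP _ w'0) => j jk.
rewrite lerBlDr; apply: (le_trans (objr_le w0 jk)).
apply: (le_trans (breg_mix_Lipschitz H (w0 k) (w0 j) (w'0 k) (w'0 j) (lamM k) (lamM j) (ltW (lamk jk)))).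
rewrite -addrA lerD2l.
apply: (@le_trans _ _ (`|w k - w' k| * K + `|w j - w' j| * K)).
  by rewrite lerD// ler_wpM2l.
rewrite -mulrDl mulrC ler_wpM2l//; first exact: le_trans (bK k k).
exact: (@ge_sum2 (fun i => `|w i - w' i|)).
Qed.

Lemma uniformw_simplex : simplex (uniformw R n).
Proof.
have n0 : n%:R != 0 :> R by rewrite pnatr_eq0 -lt0n; exact: leq_trans hn.
split=> [i|]; first by rewrite ffunE invr_ge0.
under eq_bigr do rewrite ffunE.
by rewrite sumr_const card_ord -[_ *+ n]mulr_natr mulVf.
Qed.

(** [wstar] is picked by [xget] with a default, so it is a maximizer only once the supremum is known
    to be attained; this is where compactness enters. *)
Lemma wstarP : [/\ simplex (wstar rho Theta lam k),
   Tinv rho Theta lam k = (objr (wstar rho Theta lam k))%:E &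
   forall w, simplex w -> objr w <= objr (wstar rho Theta lam k)].
Proof.
have [K LK] := objr_Lipschitz.
have [|w [sw _ wmax]] := @simplex_exists_max R n objr K k 0 0 LK.
  by exists (uniformw R n); split => //; exact: uniformw_simplex.
have TE : Tinv rho Theta lam k = (objr w)%:E.
  apply/eqP; rewrite eq_le; apply/andP; split.
    apply/ereal_supP => _ [w' sw' <-]; rewrite objectiveE ?lee_fin ?wmax//.
    exact: simplex_ge0.
  by apply: ereal_sup_ubound; exists w => //; rewrite objectiveE//; exact: simplex_ge0.
have : simplex (wstar rho Theta lam k) /\ obj lam k (wstar rho Theta lam k) = Tinv rho Theta lam k.
  apply: (@xgetPex _ (uniformw R n) [set w | simplex w /\ obj lam k w = Tinv rho Theta lam k]).
  by exists w; split=> //; rewrite TE objectiveE//; exact: simplex_ge0.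
move=> [sw' e]; have w'0 := simplex_ge0 sw'.
rewrite objectiveE// in e; split=> // w2 sw2.
by rewrite -lee_fin e TE lee_fin wmax.
Qed.

Lemma objr_uniform_gt0 : 0 < objr (uniformw R n).
Proof.
have [j jk ->] := objr_attained (simplex_ge0 uniformw_simplex).
by apply: (breg_mix_gt0 H) => //; rewrite ?lamk// ffunE invr_gt0 ltr0n; exact: leq_trans hn.
Qed.

Lemma pos_of_objr_gt0 w : (forall i, 0 <= w i) -> 0 < objr w -> forall i, 0 < w i.
Proof.
move=> w0 o0 i; rewrite lt_neqAle w0 andbT; apply/eqP => wi.
have [ik|ik] := eqVneq i k.
  have [j jk] := ex_other k.
  by have := objr_le w0 jk; rewrite -ik -wi breg_mix0l leNgt o0.
by have := objr_le w0 ik; rewrite -wi breg_mix0r leNgt o0.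
Qed.

(* If some pair had slack, moving a little mass from [w j] to [w k] would strictly raise all the other pairs. *)
Lemma max_equalizes w j : simplex w -> 0 < objr w ->
  (forall w', simplex w' -> objr w' <= objr w) -> j != k ->
  mix (w k) (w j) (lam k) (lam j) = objr w.
Proof.
move=> sw o0 wmax jk; have w0 := simplex_ge0 sw; have wp := pos_of_objr_gt0 w0 o0.
apply/eqP; rewrite eq_le objr_le// andbT leNgt; apply/negP => slack.
set g := mix (w k) (w j) (lam k) (lam j) - objr w.
have g0 : 0 < g by rewrite subr_gt0.
(* Moving mass [t] lowers the pair of [j] by less than [t * C]; [t] is chosen so that this stays
   below the slack [g] and [w j] stays positive. *)
pose C := breg th psi (lam k) (lam j) + breg th psi (lam j) (lam k) + 1.
have C0 : 0 < C.
  by rewrite /C ltr_wpDl// addr_ge0// (bregman_ge0 H).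
pose t := Num.min (w j) (g / C) / 2.
have m0 : 0 < Num.min (w j) (g / C) by rewrite lt_min wp divr_gt0.
have t0 : 0 < t by rewrite divr_gt0.
have [tw tg] : t < w j /\ t * C < g.
  have : t < Num.min (w j) (g / C) by rewrite /t; lra.
  by rewrite lt_min ltr_pdivlMr// => /andP.
pose w' : {ffun 'I_n -> R} := [ffun i => if i == k then w k + t else if i == j then w j - t else w i].
have w'k : w' k = w k + t by rewrite ffunE eqxx.
have w'j : w' j = w j - t by rewrite ffunE (negbTE jk) eqxx.
have w'0 i : 0 <= w' i.
  by rewrite ffunE; case: ifP => _; [|case: ifP => _ //]; have := w0 k; lra.
have sw' : simplex w'.
  split=> //; rewrite -sw.2 (bigD1 k)//= (bigD1 j)//= w'k w'j.
  rewrite [in RHS](bigD1 k)//= [in RHS](bigD1 j)//=.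
  rewrite (eq_bigr w); last by move=> i /andP[ik ij]; rewrite ffunE (negbTE ik) (negbTE ij).
  by ring.
have := wmax _ sw'; have [i ik ->] := objr_attained w'0; rewrite leNgt => /negP; apply.
have [ij|ij] := eqVneq i j.
  rewrite ij w'k w'j.
  have := breg_mix_Lipschitz H (w0 k) (w0 j) (w'0 k) (w'0 j) (lamM k) (lamM j) (ltW (lamk jk)).
  rewrite w'k w'j.
  have -> : w k - (w k + t) = - t by ring.
  have -> : w j - (w j - t) = t by ring.
  rewrite normrN gtr0_norm// => h.
  have : g = mix (w k) (w j) (lam k) (lam j) - objr w by [].
  by move: tg; rewrite /C; lra.
rewrite w'k; have -> : w' i = w i by rewrite ffunE (negbTE ik) (negbTE ij).
apply: (le_lt_trans (objr_le w0 ik)).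
by apply: (breg_mix_lt_left H) => //; [lra|exact: lamk].
Qed.

(** By concavity the midpoint of two maximizers is a maximizer too. All pairs are equalized at the
    three points, so every pair is in the equality case of concavity and the weights are
    proportional; both sum to one. *)
Lemma maximizer_unique w w' : simplex w -> simplex w' ->
  (forall u, simplex u -> objr u <= objr w) -> (forall u, simplex u -> objr u <= objr w') ->
  0 < objr w -> w = w'.
Proof.
move=> sw sw' wmax w'max o0.
have eqo : objr w' = objr w by apply/eqP; rewrite eq_le wmax// w'max.
have o'0 : 0 < objr w' by rewrite eqo.
have w0 := simplex_ge0 sw; have w'0 := simplex_ge0 sw'.
have wp := pos_of_objr_gt0 w0 o0; have w'p := pos_of_objr_gt0 w'0 o'0.
pose v : {ffun 'I_n -> R} := [ffun i => (w i + w' i) / 2].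
have vE i : v i = (w i + w' i) / 2 by rewrite ffunE.
have v0 i : 0 <= v i by rewrite vE divr_ge0// addr_ge0.
have sv : simplex v.
  split=> //; under eq_bigr do rewrite vE.
  by rewrite -mulr_suml big_split/= sw.2 sw'.2 divff// -[1 + 1]/(2%:R) pnatr_eq0.
have key j : j != k -> mix (v k) (v j) (lam k) (lam j) <= objr w -> w k * w' j = w' k * w j.
  move=> jk h; apply: (breg_mix_midpoint H (wp k) (w0 j) (w'p k) (w'0 j) (lamM k) (lamM j) (lamk jk)).
  rewrite -!vE (max_equalizes sw)// (max_equalizes sw')// eqo.
  by move: h; lra.
have ov : objr v = objr w.
  apply/eqP; rewrite eq_le wmax//=; apply/(objr_geP _ v0) => j jk.
  have := breg_mix_concave H (w0 k) (w0 j) (w'0 k) (w'0 j) (lamM k) (lamM j) (ltW (lamk jk)).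
  rewrite -!vE (max_equalizes sw)// (max_equalizes sw')// eqo.
  by apply: le_trans; lra.
have vmax u : simplex u -> objr u <= objr v by rewrite ov; exact: wmax.
have prop j : w k * w' j = w' k * w j.
  have [->|jk] := eqVneq j k; first by rewrite mulrC.
  by apply: key => //; rewrite (max_equalizes sv)// ov.
have ekk : w k = w' k.
  have : \sum_j w k * w' j = \sum_j w' k * w j by apply: eq_bigr => j _.
  by rewrite -!mulr_sumr sw.2 sw'.2 !mulr1.
apply/ffunP => j; have := prop j; rewrite ekk => /(mulfI _) -> //.
by rewrite gt_eqF.
Qed.

(** For each coordinate, the weights at distance at least [e] form a compact set, where uniqueness
    keeps the maximum strictly below the global one. Half of that gap serves as [eta]. *)
Lemma near_maximizer e : 0 < e -> exists2 eta, 0 < eta & forall w, simplex w ->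
  objr (wstar rho Theta lam k) - eta <= objr w -> forall i, `|w i - wstar rho Theta lam k i| < e.
Proof.
move=> e0; have [sw _ wmax] := wstarP; set ws := wstar rho Theta lam k in sw wmax *.
have o0 : 0 < objr ws by apply: lt_le_trans objr_uniform_gt0 _; apply: wmax; exact: uniformw_simplex.
have [K LK] := objr_Lipschitz.
pose P i eta := forall w, simplex w -> objr ws - eta <= objr w -> `|w i - ws i| < e.
have [|i|eta eta0 h] := @ex_pos_forall R n P; last by exists eta => // w sw' hw i; exact: h.
  by move=> i r r' Pr r'0 rr' w sw' hw; apply: Pr => //; lra.
have [ex|nex] := pselect (exists w, simplex w /\ e <= `|w i - ws i|); last first.
  by exists 1 => // w sw' _; rewrite ltNge; apply/negP => h; apply: nex; exists w.
have [u [su eu umax]] := @simplex_exists_max R n objr K i (ws i) e LK ex.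
have ltu : objr u < objr ws.
  rewrite lt_neqAle wmax// andbT; apply/eqP => eq_u.
  have uw : u = ws.
    by apply: maximizer_unique => //; rewrite eq_u.
  by move: eu; rewrite uw subrr normr0 leNgt e0.
exists ((objr ws - objr u) / 2); first by rewrite divr_gt0// subr_gt0.
move=> w sw' hw; rewrite ltNge; apply/negP => /(umax _ sw') h; lra.
Qed.

End fixed_instance.

End chartime.

(** * Continuity of the characteristic time and of the optimal weights *)

Section perturbation_arith.
Context {R : realType}.

Lemma sup_perturb (c cl b1 b2 e e2 : R) :
  c - e2 <= b1 -> b1 <= cl -> cl - e2 <= b2 -> b2 <= c -> e2 <= e / 2 -> `|cl - c| <= e.
Proof. by move=> *; rewrite ler_norml; apply/andP; split; lra. Qed.

Lemma sup_perturb_lower (c cl b1 b2 e1 e2 : R) :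
  c - e2 <= b1 -> b1 <= cl -> cl - e2 <= b2 -> e2 <= e1 / 2 -> c - e1 <= b2.
Proof. by move=> *; lra. Qed.

Lemma perturb_chain (cl m1 m2 m3 e e2 : R) :
  cl <= m3 -> m3 <= m2 + e2 -> m2 - e2 <= m1 -> e2 <= e / 2 -> cl - e <= m1.
Proof. by move=> *; lra. Qed.

End perturbation_arith.

Section stability.
Context {R : realType} (rho : {measure set R -> \bar R}) (Theta : set R) (th psi : R -> R).
Local Notation M := (Mset rho Theta).
Hypothesis H : bregman_family M th psi.
Hypothesis dE : forall x y, M x -> M y -> dKL rho Theta x y = (breg th psi x y)%:E.
Variable n : nat.
Hypothesis hn : (2 <= n)%N.
Implicit Types (lam : 'I_n -> R) (k j : 'I_n) (w : {ffun 'I_n -> R}).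

Local Notation mix := (breg_mix th psi).

Lemma breg_mix_perturb_le (a c p q p' q' K eta : R) : 0 <= a -> 0 <= c ->
  M p -> M q -> M p' -> M q' -> q <= p -> q' <= p' -> `|th p| <= K -> `|th q| <= K ->
  (forall y, `|th y| <= K -> `|breg th psi p' y - breg th psi p y| <= eta) ->
  (forall y, `|th y| <= K -> `|breg th psi q' y - breg th psi q y| <= eta) ->
  mix a c p' q' <= mix a c p q + (a + c) * eta.
Proof.
move=> a0 c0 Mp Mq Mp' Mq' qp qp' pK qK hp hq.
have [y yb ->] := breg_mix_attained th psi a0 c0 qp.
have My := bregman_between H Mq Mp yb; move/andP: yb => [qy yp].
have yK : `|th y| <= K.
  have h1 := th_le H Mq My qy; have h2 := th_le H My Mp yp.
  move: pK qK; rewrite !ler_norml => /andP[_ pK] /andP[qK _].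
  by rewrite (le_trans qK h1) (le_trans h2 pK).
apply: (le_trans (breg_mix_le H a0 c0 Mp' Mq' My qp')).
have k1 : breg th psi p' y <= breg th psi p y + eta.
  by rewrite -lerBlDl; apply: le_trans (ler_norm _) (hp y yK).
have k2 : breg th psi q' y <= breg th psi q y + eta.
  by rewrite -lerBlDl; apply: le_trans (ler_norm _) (hq y yK).
have := lerD (ler_wpM2l a0 k1) (ler_wpM2l c0 k2).
by rewrite !mulrDr mulrDl => h; apply: (le_trans h); rewrite addrACA.
Qed.

Lemma breg_mix_perturb (mu : 'I_n -> R) k eta : (forall i, M (mu i)) -> unique_max mu k ->
  0 < eta -> exists2 r : R, 0 < r & forall lam, (forall i, `|lam i - mu i| < r) ->
  [/\ forall i, M (lam i), unique_max lam k &
    forall (a c : R) j, 0 <= a -> 0 <= c -> j != k ->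
      `|mix a c (lam k) (lam j) - mix a c (mu k) (mu j)| <= (a + c) * eta].
Proof.
(* Bounds the natural parameters of all means close to those of [mu], hence of every minimizer lying
   between two of them. *)
move=> muM muk eta0; pose K := \sum_i `|th (mu i)| + 1.
have muK i : `|th (mu i)| + 1 <= K by rewrite lerD2r (bigD1 i)//= lerDl sumr_ge0.
pose P i (r : R) := forall p, `|p - mu i| < r -> [/\ M p, `|th p| <= K &
  forall y, `|th y| <= K -> `|breg th psi p y - breg th psi (mu i) y| <= eta].
have [||r1 r10 hr1] := @ex_pos_forall R n P.
- by move=> i r r' Pr _ rr' p hp; apply: Pr; exact: lt_le_trans rr'.
- move=> i; have [r r0 hr] := breg_cont_left H K (muM i) eta0.
  have [r' r'0 hr'] := bregman_cont H (muM i) ltr01.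
  exists (Num.min r r'); first by rewrite lt_min r0.
  move=> p; rewrite lt_min => /andP[/hr [Mp h1] /hr' [_ h2 _]]; split=> //.
  apply: le_trans (muK i).
  have -> : th p = th (mu i) + (th p - th (mu i)) by rewrite addrC subrK.
  by apply: (le_trans (ler_normD _ _)); rewrite lerD2l ltW.
(* Half the gap, since both arms may move. *)
pose Q j (r : R) := j != k -> r <= (mu k - mu j) / 2.
have [||r2 r20 hr2] := @ex_pos_forall R n Q.
- by move=> i r r' Qr _ rr' /Qr; exact: le_trans.
- move=> j; have [->|jk] := eqVneq j k; first by exists 1 => // /eqP.
  by exists ((mu k - mu j) / 2) => //; rewrite divr_gt0// subr_gt0 muk.
exists (Num.min r1 r2); first by rewrite lt_min r10.
move=> lam hlam.
have h1 i : `|lam i - mu i| < r1 by have := hlam i; rewrite lt_min => /andP[].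
have h2 i : `|lam i - mu i| < r2 by have := hlam i; rewrite lt_min => /andP[].
have lamk : unique_max lam k.
  move=> j jk; have h := hr2 j jk.
  have := h2 j; have := h2 k; rewrite !ltr_norml => /andP[e1 e2] /andP[e3 e4].
  lra.
have lamM i : M (lam i) by have [] := hr1 i _ (h1 i).
split=> // a c j a0 c0 jk; have ac0 : 0 <= a + c by rewrite addr_ge0.
have [_ Kk bk] := hr1 k _ (h1 k); have [_ Kj bj] := hr1 j _ (h1 j).
have muK' i : `|th (mu i)| <= K by apply: le_trans (muK i); rewrite lerDl.
have l1 := breg_mix_perturb_le a0 c0 (muM k) (muM j) (lamM k) (lamM j)
  (ltW (muk _ jk)) (ltW (lamk _ jk)) (muK' k) (muK' j) bk bj.
have bk' y : `|th y| <= K -> `|breg th psi (mu k) y - breg th psi (lam k) y| <= eta.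
  by rewrite distrC; exact: bk.
have bj' y : `|th y| <= K -> `|breg th psi (mu j) y - breg th psi (lam j) y| <= eta.
  by rewrite distrC; exact: bj.
have l2 := breg_mix_perturb_le a0 c0 (lamM k) (lamM j) (muM k) (muM j)
  (ltW (lamk _ jk)) (ltW (muk _ jk)) Kk Kj bk' bj'.
rewrite ler_norml lerBlDl l1 andbT lerNl opprB lerBlDl //.
Qed.

Local Notation Tr lam k := (fine (Tinv rho Theta lam k)).
Local Notation ws lam k := (wstar rho Theta lam k).

Lemma Tinv_gt0 lam k : (forall i, M (lam i)) -> unique_max lam k -> 0 < Tr lam k.
Proof.
move=> lamM lamk; have [sw -> wmax] := wstarP H dE hn lamM lamk.
apply: lt_le_trans (objr_uniform_gt0 H dE hn lamM lamk) _; apply: wmax.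
exact: uniformw_simplex.
Qed.

(** The last clause evaluates the weights of [lam] at another instance [lam']: targets are computed
    from one set of empirical means and tested against a later one. For the weights an upper bound
    is kept, since it serves to bound the pulls. *)
Lemma chartime_stable (mu : 'I_n -> R) k eta : (forall i, M (mu i)) -> unique_max mu k ->
  0 < eta -> exists2 r : R, 0 < r & forall lam, (forall i, `|lam i - mu i| < r) ->
  [/\ (forall i, M (lam i)) /\ unique_max lam k,
    `|Tr lam k - Tr mu k| <= eta,
    forall i, 0 <= ws lam k i <= ws mu k i + eta &
    forall lam', (forall i, `|lam' i - mu i| < r) -> forall j, j != k ->
      Tr lam k - eta <= mix (ws lam k k) (ws lam k j) (lam' k) (lam' j)].
Proof.
move=> muM muk eta0.
have [smu Tmu maxmu] := wstarP H dE hn muM muk.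
have [eta1 eta10 near1] := near_maximizer H dE hn muM muk eta0.
(* The objectives of [lam] and [mu] differ by at most [eta2] on the simplex, so a maximizer for
   [lam] is within [2 * eta2 <= eta1] of optimal for [mu]. *)
pose eta2 := Num.min (eta / 2) (eta1 / 2).
have eta20 : 0 < eta2 by rewrite lt_min !divr_gt0.
have [e21 e22] : eta2 <= eta / 2 /\ eta2 <= eta1 / 2.
  by apply/andP; rewrite -le_min.
have [r r0 hr] := breg_mix_perturb muM muk eta20.
exists r => // lam hlam; have [lamM lamk hmix] := hr lam hlam.
have [slam Tlam maxlam] := wstarP H dE hn lamM lamk.
have mixle w j : simplex w -> j != k ->
  `|mix (w k) (w j) (lam k) (lam j) - mix (w k) (w j) (mu k) (mu j)| <= eta2.
  move=> sw jk; apply: (le_trans (hmix _ _ _ (simplex_ge0 sw k) (simplex_ge0 sw j) jk)).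
  by rewrite ler_piMl ?simplex_le1// ltW.
have o1 w : simplex w -> objr rho Theta mu k w - eta2 <= objr rho Theta lam k w.
  move=> sw; have w0 := simplex_ge0 sw.
  apply/(objr_geP H dE hn lamM lamk _ w0) => j jk.
  have h := objr_le H dE hn muM muk w0 jk.
  have := mixle w j sw jk; rewrite ler_distl => /andP[h' _].
  by apply: le_trans h'; rewrite lerD2r.
have o2 w : simplex w -> objr rho Theta lam k w - eta2 <= objr rho Theta mu k w.
  move=> sw; have w0 := simplex_ge0 sw.
  apply/(objr_geP H dE hn muM muk _ w0) => j jk.
  have h := objr_le H dE hn lamM lamk w0 jk.
  have := mixle w j sw jk; rewrite ler_distl => /andP[_ h'].
  by rewrite lerBlDr; apply: le_trans h'.
rewrite Tmu Tlam /=.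
have a1 := o1 _ smu; have a2 := maxlam _ smu; have a3 := o2 _ slam; have a4 := maxmu _ slam.
split=> //.
- exact: sup_perturb a1 a2 a3 a4 e21.
- move=> i; rewrite (simplex_ge0 slam)/=.
  have := near1 _ slam (sup_perturb_lower a1 a2 a3 e22) i.
  by rewrite ltr_norml => /andP[_ h]; rewrite -lerBlDl ltW.
move=> lam' hlam' j jk; have [_ _ hmix'] := hr lam' hlam'.
have := hmix' _ _ _ (simplex_ge0 slam k) (simplex_ge0 slam j) jk.
have le1 : (ws lam k k + ws lam k j) * eta2 <= eta2 by rewrite ler_piMl ?simplex_le1// ltW.
move=> /le_trans /(_ le1); rewrite ler_distl => /andP[h1 _].
have := mixle _ j slam jk; rewrite ler_distl => /andP[_ h2].
have h3 := objr_le H dE hn lamM lamk (simplex_ge0 slam) jk.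
exact: perturb_chain h3 h2 h1 e21.
Qed.

(** Variables replace [Tinv] and [wstar]: this is the form in which the analysis of a run assumes
    stability. *)
Lemma chartime_stable_ex (mu : 'I_n -> R) k : (forall i, M (mu i)) -> unique_max mu k ->
  exists c (wm : {ffun 'I_n -> R}), [/\ Tr mu k = c, 0 < c, simplex wm &
  forall eta, 0 < eta -> exists2 r : R, 0 < r & forall lam, (forall i, `|lam i - mu i| < r) ->
  exists cl (wl : {ffun 'I_n -> R}), [/\ (forall i, M (lam i)) /\ unique_max lam k,
    Tr lam k = cl /\ ws lam k = wl, `|cl - c| <= eta,
    forall i, 0 <= wl i <= wm i + eta &
    forall lam', (forall i, `|lam' i - mu i| < r) -> forall j, j != k ->
      cl - eta <= mix (wl k) (wl j) (lam' k) (lam' j)]].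
Proof.
move=> muM muk; exists (Tr mu k), (ws mu k); split=> //.
- exact: Tinv_gt0.
- by have [] := wstarP H dE hn muM muk.
move=> eta eta0; have [r r0 hr] := chartime_stable muM muk eta0.
by exists r => // lam /hr [? ? ? ?]; exists (Tr lam k), (ws lam k).
Qed.

End stability.

(** * Deterministic analysis of a run *)

Section rates.
Context {R : realType}.
Implicit Types (x u L : R).

Lemma cnat_ge x : x <= (cnat x)%:R.
Proof.
have [x0|x0] := ltP x 0; first exact: le_trans (ltW x0) _.
rewrite /cnat natr_absz ger0_norm; first exact: ceil_ge.
by rewrite ceil_ge0; apply: lt_le_trans x0; rewrite ltrN10.
Qed.

Lemma cnat_lt x : 0 <= x -> (cnat x)%:R < x + 1.
Proof.
move=> x0; rewrite /cnat natr_absz ger0_norm.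
  have := ceilB1_lt x; rewrite intrD; lra.
by rewrite ceil_ge0; apply: lt_le_trans x0; rewrite ltrN10.
Qed.

Lemma cnat_le x u : 0 <= x -> x <= u -> (cnat x <= cnat u)%N.
Proof.
move=> x0 xu; rewrite -lez_nat /cnat !gez0_abs ?le_ceil// ceil_ge0.
  by apply: lt_le_trans (le_trans x0 xu); rewrite ltrN10.
by apply: lt_le_trans x0; rewrite ltrN10.
Qed.

Lemma cnat_max x u : 0 <= x ->
  (cnat x + absz (Num.max 0%Z (Num.ceil u - Num.ceil x)%R) = cnat (Num.max x u))%N.
Proof.
move=> x0; have cx0 : (0 <= Num.ceil x)%R.
  by rewrite ceil_ge0; apply: lt_le_trans x0; rewrite ltrN10.
have [xu|/ltW ux] := leP x u; rewrite /cnat.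
  have := le_ceil xu; move: (Num.ceil x) (Num.ceil u) cx0 => a b a0 ab.
  by rewrite max_r ?subr_ge0//; lia.
have := le_ceil ux; move: (Num.ceil x) (Num.ceil u) cx0 => a b a0 ab.
by rewrite max_l ?subr_le0//; lia.
Qed.

Lemma ln_le_sub1 x : 0 < x -> ln x <= x - 1.
Proof.
move=> x0; have := expR_ge1Dx (ln x); rewrite lnK ?posrE//; lra.
Qed.

Lemma ln_sqr_le u : 0 < u -> ln (u ^+ 2) <= 2 * u.
Proof.
by move=> u0; rewrite lnXn//; have := ln_le_sub1 u0; lra.
Qed.

Lemma beta_le alpha (A kap : R) : 0 <= alpha -> 1 <= A -> 0 < kap ->
  exists2 L0 : R, 1 <= L0 & forall (delta : R) (t : nat), 0 < delta -> L0 <= logd delta ->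
    (0 < t)%N -> t%:R <= A * logd delta ->
    beta alpha t (delta / 2) <= (1 + kap) * logd delta.
Proof.
(* [C * sqrt L] bounds the excess of the threshold over [L]: [4] covers [ln 2] and [ln (L + ln 2)],
   the rest covers [alpha * ln t]. All logarithms are reduced to [sqrt L] by [ln_sqr_le]. *)
move=> al0 A1 kap0; pose C := 4 + alpha * (A + 2).
have C0 : 0 < C by rewrite /C; have := mulr_ge0 al0 (addr_ge0 (le_trans ler01 A1) (ler0n R 2)); lra.
exists (1 + (C / kap) ^+ 2); first by rewrite lerDl sqr_ge0.
move=> delta t d0 hL t0 tA; set L := logd delta in hL tA *.
have L1' : 1 <= L by apply: le_trans hL; rewrite lerDl sqr_ge0.
have L0 : 0 < L by lra.
pose u := Num.sqrt L; have u0 : 0 < u by rewrite sqrtr_gt0.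
have uL : u ^+ 2 = L by rewrite sqr_sqrtr// ltW.
have u1 : 1 <= u by rewrite -sqrtr1 ler_wsqrtr.
have uC : C <= kap * u.
  rewrite mulrC -ler_pdivrMr//.
  rewrite -(@ler_pXn2r _ 2)// ?nnegrE ?divr_ge0 ?(ltW C0) ?(ltW kap0) ?(ltW u0)// uL.
  by apply: le_trans hL; rewrite lerDr.
have ln2 : ln (2 : R) <= 1 by have := @ln_le_sub1 2 ltac:(lra); lra.
have ln20 : 0 <= ln (2 : R) by rewrite ln_ge0//; lra.
have dl : ln (delta / 2)^-1 = L + ln 2.
  by rewrite invfM invrK lnM ?posrE ?invr_gt0//.
have t0' : (0 : R) < t%:R by rewrite ltr0n.
have lnt : ln (t%:R : R) <= (A + 2) * u.
  apply: (@le_trans _ _ (ln (A * L))); first by rewrite ler_ln ?posrE// mulr_gt0//; lra.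
  rewrite lnM ?posrE//; last by lra.
  have h1 := @ln_le_sub1 A ltac:(lra); have := ln_sqr_le u0; rewrite uL => h2.
  have : A * 1 <= A * u by rewrite ler_wpM2l//; lra.
  lra.
have LL : 0 < L + ln 2 by lra.
have lnL : ln (L + ln 2) <= 3 * u.
  apply: (@le_trans _ _ (ln (2 * L))); first by rewrite ler_ln ?posrE//; lra.
  rewrite lnM ?posrE//; have := ln_sqr_le u0; rewrite uL; lra.
rewrite /beta dl.
have -> : ln ((L + ln 2) * (t%:R `^ alpha) / (delta / 2)) = ln (L + ln 2) + alpha * ln t%:R + (L + ln 2).
  rewrite lnM ?posrE ?invr_gt0 ?divr_gt0 ?mulr_gt0 ?powR_gt0//.
  by rewrite lnM ?posrE ?powR_gt0// ln_powR dl.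
have : alpha * ln t%:R <= alpha * ((A + 2) * u) by rewrite ler_wpM2l.
have : C * u <= kap * u * u by rewrite ler_wpM2r// ltW.
rewrite -mulrA -expr2 uL /C; lra.
Qed.

End rates.

(** * Pull counts in Stage II and the worst-case number of pulls *)

Section stage2.
Context {R : realType} (rho : {measure set R -> \bar R}) (Theta : set R).
Variables (n : nat) (alpha delta : R) (s : 'I_n -> nat -> R).
Local Notation targets := (step_targets rho Theta alpha delta s).

Lemma step_targets_le N i : (targets N).2 i <= L2 n delta.
Proof.
rewrite /step_targets; case: istar => [k|] //=.
by case: ifP => _ //=; rewrite ge_min lexx orbT.
Qed.

(* The number of pulls of arm [i] is always the ceiling of the running maximum [mT i] of its targets. *)
Lemma stage2_ceil (good : ('I_n -> R) -> Prop) (hi : 'I_n -> R) :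
  (forall N mT, (forall i, L1 delta <= mT i <= hi i) -> (forall i, N i = cnat (mT i)) ->
     good (targets N).2 /\ forall i, (targets N).2 i <= hi i) ->
  forall fuel N mT wprev, (0 < fuel)%N -> (forall i, L1 delta <= mT i <= hi i) ->
    (forall i, N i = cnat (mT i)) ->
  exists mT' T, [/\ good T, forall i, T i <= mT' i, forall i, L1 delta <= mT' i <= hi i &
    forall i, stage2 rho Theta alpha delta s fuel N mT wprev i = cnat (mT' i)].
Proof.
move=> step; elim=> [//|f IH] N mT wprev _ hmT hN.
have [gT hT] := step _ _ hmT hN; rewrite [stage2]lock /= -lock.
set T := (targets N).2 in gT hT *.
pose mT2 i := Num.max (mT i) (T i).
have hmT2 i : L1 delta <= mT2 i <= hi i.
  by have /andP[h1 h2] := hmT i; rewrite le_max h1/= ge_max h2 hT.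
have hN2 i : addn (N i) (absz (Num.max 0%Z (Num.ceil (T i) - Num.ceil (mT i))%R)) = cnat (mT2 i).
  rewrite hN cnat_max//; have /andP[h1 _] := hmT i.
  by apply: le_trans h1; exact: sqrtr_ge0.
have now : exists mT' T0, [/\ good T0, forall i, T0 i <= mT' i, forall i, L1 delta <= mT' i <= hi i &
    forall i, addn (N i) (absz (Num.max 0%Z (Num.ceil (T i) - Num.ceil (mT i))%R)) = cnat (mT' i)].
  by exists mT2, T; split=> // i; rewrite le_max lexx orbT.
rewrite [stage2 _ _ _ _ _ _ _ _ _]/=; case: ifP => _; first exact: now.
(* If the fuel ends here, the targets just computed are the last ones. *)
by case: f IH => [_|f IH]; [exact: now|exact: IH].
Qed.

(** [good] describes the last targets computed and [hi] bounds all of them, whichever iteration ends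
    Stage II. It is used with precise targets on accurate samples, and with a trivial [good] and
    [hi] equal to [L3] for the worst case. *)
Lemma N_stage2_ceil (good : ('I_n -> R) -> Prop) (hi : 'I_n -> R) :
  0 < logd delta -> (forall i, L1 delta <= hi i) ->
  (forall N mT, (forall i, L1 delta <= mT i <= hi i) -> (forall i, N i = cnat (mT i)) ->
     good (targets N).2 /\ forall i, (targets N).2 i <= hi i) ->
  exists mT' T, [/\ good T, forall i, T i <= mT' i, forall i, L1 delta <= mT' i <= hi i &
    forall i, N_stage2 rho Theta alpha delta s i = cnat (mT' i)].
Proof.
move=> Lp hL step; apply: stage2_ceil => //.
- rewrite -(ltr_nat R); apply: lt_le_trans (cnat_ge _); exact: Lp.
- by move=> i; rewrite lexx hL.
Qed.

Lemma istar_unique N k : (forall j, j != k -> emp s N j < emp s N k) -> istar s N = Some k.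
Proof.
move=> hk; rewrite /istar; case: pickP => [i /andP[/forallP h _]|/(_ k)].
  have [->//|/hk] := eqVneq i k; by rewrite ltNge h.
rewrite /is_istar; move=> /negP; case; apply/andP; split; apply/forallP => j.
  by have [->//|/hk/ltW] := eqVneq j k.
by apply/implyP => jk; apply: hk; apply: contraTneq jk => ->; rewrite ltnn.
Qed.

Lemma L1_le_L3 : 1 <= logd delta -> L1 delta <= L3 delta.
Proof.
rewrite /L1 /L3; move: (logd delta) => L L1.
have L0 : 0 <= L by lra.
apply: (@le_trans _ _ L); last by rewrite expr2 ler_peMr.
rewrite -[leRHS]sqr_sqrtr// expr2 ler_peMr ?sqrtr_ge0//.
by rewrite -sqrtr1 ler_wsqrtr.
Qed.

Lemma L2_le_L3 : (0 < n)%N -> 1 <= logd delta -> L2 n delta <= L3 delta.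
Proof.
move=> n0; rewrite /L2 /L3; move: (logd delta) => L L1.
have n0' : (0 : R) < n%:R by rewrite ltr0n.
rewrite ler_pdivrMr// expr2 -mulrA ler_wpM2l//; first by lra.
have h : ln L <= L by have := @ln_le_sub1 R L ltac:(lra); lra.
by apply: (le_trans h); rewrite ler_peMr ?ler1n//; lra.
Qed.

Lemma Ntotal_le : (0 < n)%N -> 1 <= logd delta ->
  (Ntotal rho Theta alpha delta s <= n * cnat (L3 delta))%N.
Proof.
move=> n0 hL.
have [mT [T [_ _ hmT hN]]] := @N_stage2_ceil (fun=> True) (fun=> L3 delta)
  (lt_le_trans ltr01 hL) (fun=> L1_le_L3 hL)
  (fun N mT _ _ => conj Logic.I (fun i => le_trans (step_targets_le N i) (L2_le_L3 n0 hL))).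
have N2 i : (N_stage2 rho Theta alpha delta s i <= cnat (L3 delta))%N.
  have /andP[h1 h2] := hmT i; rewrite hN cnat_le//.
  by apply: le_trans h1; exact: sqrtr_ge0.
have -> : (n * cnat (L3 delta) = \sum_(i < n) cnat (L3 delta))%N.
  by rewrite sum_nat_const card_ord.
rewrite /Ntotal /tau; case: ifP => _; apply: leq_sum => i _ //.
by rewrite geq_max N2 leqnn.
Qed.

End stage2.

(** * Runs whose empirical means are accurate *)

Lemma ratio_perturb {R : realType} (w c cl wl eta : R) : 0 <= w <= 1 -> 0 < c ->
  0 <= wl <= w + eta -> `|cl - c| <= eta -> eta <= c / 2 ->
  wl / cl <= w / c + 2 * eta * (c + 1) / c ^+ 2.
Proof.
move=> /andP[w0 w1] c0 /andP[wl0 wl1]; rewrite ler_distl => /andP[cl1 cl2] ec.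
have eta0 : 0 <= eta by lra.
have cl0 : 0 < cl by lra.
rewrite ler_pdivrMr//; apply: (le_trans wl1).
set q := w / c + 2 * eta * (c + 1) / c ^+ 2.
have q0 : 0 <= q by rewrite addr_ge0// ?divr_ge0 ?mulr_ge0 ?exprn_ge0// ?ltW//; lra.
apply: (@le_trans _ _ (q * (c - eta))); last by rewrite ler_wpM2l.
pose x := eta / c.
have ex : eta = x * c by rewrite /x divfK// gt_eqF.
have x0 : 0 <= x by rewrite divr_ge0// ltW.
have x2 : x <= 1 / 2 by rewrite ler_pdivrMr//; lra.
have -> : q * (c - eta) = w - w * x + 2 * x * (c + 1) * (1 - x).
  by rewrite /q ex; field; rewrite gt_eqF.
have h1 : w * x <= 1 * x by rewrite ler_wpM2r.
have h2 : 0 <= x * (c + 1) * (1 - 2 * x).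
  by apply: mulr_ge0; [apply: mulr_ge0|]; lra.
rewrite ex; lra.
Qed.

Lemma ge_ln {R : realType} (x L : R) : expR x <= L -> x <= ln L.
Proof. by move=> h; rewrite -ler_expR lnK// posrE; exact: lt_le_trans (expR_gt0 _) h. Qed.

Lemma linear_absorb {R : realType} (L a b N : R) :
  N <= b / 2 * L -> L * (a + b / 2) + N <= (a + b) * L.
Proof. by move=> h; lra. Qed.

Lemma le_half_mul {R : realType} (N e L : R) : 2 * N <= L * e -> N <= e / 2 * L.
Proof. by move=> h; lra. Qed.

Section run.
Context {R : realType} (rho : {measure set R -> \bar R}) (Theta : set R) (th psi : R -> R).
Local Notation M := (Mset rho Theta).
Hypothesis H : bregman_family M th psi.
Hypothesis dE : forall x y, M x -> M y -> dKL rho Theta x y = (breg th psi x y)%:E.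
Variable n : nat.
Hypothesis hn : (2 <= n)%N.
Local Notation mix := (breg_mix th psi).

Lemma ZijE s N (k j : 'I_n) : M (emp s N k) -> M (emp s N j) -> (0 < N k)%N ->
  emp s N j <= emp s N k ->
  Zij rho Theta s N k j = (mix (N k)%:R (N j)%:R (emp s N k) (emp s N j))%:E.
Proof.
move=> Mk Mj Nk le_jk.
have Mx : M (((N k)%:R * emp s N k + (N j)%:R * emp s N j) / (N k + N j)%:R).
  apply: (bregman_between H Mj Mk); rewrite natrD; apply: mix_mean_between => //.
  by rewrite ltr_wpDr// ltr0n.
by rewrite /Zij /dext !asboolT// !dE// natrD.
Qed.

(** Here [c] stands for the inverse of the characteristic time. Without the factor [alpha] the
    targets would bring the statistics to about [L]; the surplus [(alpha - 1) * L] pays for the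
    lower-order terms of the threshold and for the perturbation. *)
Lemma Ntotal_good (mu : 'I_n -> R) k (alpha e c : R) (wm : {ffun 'I_n -> R}) :
  0 < c -> simplex wm ->
  (forall eta, 0 < eta -> exists2 r : R, 0 < r & forall lam, (forall i, `|lam i - mu i| < r) ->
   exists cl (wl : {ffun 'I_n -> R}), [/\ (forall i, M (lam i)) /\ unique_max lam k,
    fine (Tinv rho Theta lam k) = cl /\ wstar rho Theta lam k = wl, `|cl - c| <= eta,
    forall i, 0 <= wl i <= wm i + eta &
    forall lam', (forall i, `|lam' i - mu i| < r) -> forall j, j != k ->
      cl - eta <= mix (wl k) (wl j) (lam' k) (lam' j)]) ->
  1 < alpha -> 0 < e ->
  exists2 r : R, 0 < r & exists2 L0 : R, 1 <= L0 & forall delta s, 0 < delta -> L0 <= logd delta ->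
    (forall i (N : 'I_n -> nat), (cnat (L1 delta) <= N i)%N -> (N i <= cnat (L3 delta))%N ->
       `|emp s N i - mu i| <= r) ->
    (Ntotal rho Theta alpha delta s)%:R <= (alpha / c + e) * logd delta.
Proof.
move=> c0 swm stab al1 e0.
have n0 : (0 : R) < n%:R by rewrite ltr0n; exact: leq_trans hn.
have al0 : 0 < alpha by lra.
(* Half of [e] is shared among the arms; the other half pays for rounding up the targets. *)
pose e1 := e / 2 / n%:R; have e10 : 0 < e1 by rewrite !divr_gt0.
have ne1 : n%:R * e1 = e / 2 by rewrite /e1 mulrC divfK// gt_eqF.
(* In this order: the loss [alpha * eta / cl] in the statistic is at most [(alpha - 1) / 4]; [cl]
   stays above [c / 2]; the rate of each arm grows by at most [e1]. *)
pose eta := Num.min (c * (alpha - 1) / (8 * alpha)) (Num.min (c / 2) (e1 * c ^+ 2 / (2 * alpha * (c + 1)))).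
have c10 : 0 < c + 1 by lra.
have eta0 : 0 < eta.
  have al1' : 0 < alpha - 1 by lra.
  have a8 : 0 < 8 * alpha by rewrite mulr_gt0.
  have a2 : 0 < 2 * alpha * (c + 1) by rewrite !mulr_gt0.
  have ec : 0 < e1 * c ^+ 2 by rewrite mulr_gt0// exprn_gt0.
  by rewrite !lt_min !divr_gt0// mulr_gt0.
have [et1 et2 et3] : [/\ eta <= c * (alpha - 1) / (8 * alpha), eta <= c / 2 &
    eta <= e1 * c ^+ 2 / (2 * alpha * (c + 1))].
  by split; rewrite /eta !ge_min lexx ?orbT.
clearbody eta.
have [r1 r10 hr] := stab _ eta0.
(* The other half of the radius is left for the shift [eps] in [bvec]. *)
exists (r1 / 2); first by rewrite divr_gt0.
have q0 : 0 < alpha / c by rewrite divr_gt0.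
have n1 : (1 : R) <= n%:R by rewrite ler1n; exact: leq_trans hn.
have A1 : 1 <= alpha / c + n%:R * e1 + n%:R by rewrite ne1; lra.
have kap0 : 0 < (alpha - 1) / 2 by lra.
have [Lb Lb1 hb] := beta_le (ltW al0) A1 kap0.
have x1 := expR_gt0 (2 / r1 + 1); have x2 := expR_gt0 (n%:R * (alpha / c + e1)).
have x3 : 0 <= (e1^-1) ^+ 2 by rewrite sqr_ge0.
have x4 : 0 < 2 * n%:R / e by rewrite divr_gt0// mulr_gt0.
(* The terms ensure in turn the threshold bound, [eps < r1 / 2], targets below the cap [L2],
   [L1 <= hi], [hi <= L3], and a rounding error [n] of at most [e / 2 * L]. *)
pose L0 := Lb + expR (2 / r1 + 1) + expR (n%:R * (alpha / c + e1)) + (e1^-1) ^+ 2 + (alpha / c + e1) + 2 * n%:R / e.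
exists L0; first by rewrite /L0; lra.
move=> delta s d0 hL hemp; set L := logd delta in hL *.
have [l1 l2 l3 l4] : [/\ Lb <= L, expR (2 / r1 + 1) <= L, expR (n%:R * (alpha / c + e1)) <= L & (e1^-1) ^+ 2 <= L].
  by rewrite /L0 in hL; split; lra.
have [l5 l6] : alpha / c + e1 <= L /\ 2 * n%:R / e <= L by rewrite /L0 in hL; split; lra.
have L1' : 1 <= L by lra.
have Lp : 0 < L by lra.
clear hL x1 x2 x3 x4; clearbody L0.
have wm1 i : 0 <= wm i <= 1.
  rewrite (simplex_ge0 swm)/=; have [j ji] := ex_other hn i.
  by have := simplex_le1 swm ji; have := simplex_ge0 swm j; lra.
pose hi i := L * (alpha * (wm i / c) + e1).
have hi_le i : hi i <= L * (alpha / c + e1).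
  rewrite /hi ler_pM2l// lerD2r ler_pM2l// ler_piMl ?invr_ge0 ?(ltW c0)//.
  by have /andP[] := wm1 i.
have hiL2 i : hi i <= L2 n delta.
  apply: (le_trans (hi_le i)); rewrite /L2 -/L -mulrA ler_pM2l// ler_pdivlMr// mulrC.
  exact: ge_ln.
have hiL3 i : hi i <= L3 delta.
  by apply: (le_trans (hi_le i)); rewrite /L3 -/L expr2 ler_pM2l.
have L1hi i : L1 delta <= hi i.
  apply: (@le_trans _ _ (L * e1)); last first.
    rewrite /hi ler_pM2l// lerDr mulr_ge0// ?divr_ge0// ?(ltW c0)// ?(ltW al0)//.
    by have /andP[] := wm1 i.
  rewrite /L1 -/L.
  have u0 : 0 < Num.sqrt L by rewrite sqrtr_gt0.
  rewrite -{2}(@sqr_sqrtr _ L (ltW Lp)) expr2 -mulrA ler_peMr ?(ltW u0)//.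
  rewrite -ler_pdivrMr// mul1r -(@ler_pXn2r _ 2)// ?nnegrE ?invr_ge0 ?(ltW e10) ?(ltW u0)//.
  by rewrite sqr_sqrtr// ltW.
have empr (N : 'I_n -> nat) mT : (forall i, L1 delta <= mT i <= hi i) -> (forall i, N i = cnat (mT i)) ->
    forall i, `|emp s N i - mu i| <= r1 / 2.
  move=> hmT hN i; have /andP[h1 h2] := hmT i.
  have s0 : 0 <= L1 delta by exact: sqrtr_ge0.
  apply: hemp; rewrite hN cnat_le// ?(le_trans h2 (hiL3 i))//.
  exact: le_trans h1.
have lt12 : r1 / 2 < r1 by lra.
have emp_max (N : 'I_n -> nat) : (forall i, `|emp s N i - mu i| <= r1 / 2) ->
    (forall i, M (emp s N i)) /\ unique_max (emp s N) k.
  move=> hN; have h i : `|emp s N i - mu i| < r1 by exact: le_lt_trans lt12.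
  by have [cl [wl [hh _ _ _ _]]] := hr _ h.
have lnL : 2 / r1 + 1 <= ln L by exact: ge_ln.
have r1p : 0 < 2 / r1 by rewrite divr_gt0.
have epsr : eps delta < r1 / 2.
  rewrite /eps -/L -[r1 / 2]invrK ltf_pV2 ?posrE ?invr_gt0 ?divr_gt0//; last by lra.
  by rewrite invf_div; lra.
have eps0 : 0 < eps delta by rewrite /eps -/L invr_gt0; lra.
(* The targets are a multiple of weights that remain nearly optimal for every instance close to
   [mu], in particular for the final empirical means. *)
pose good (T : 'I_n -> R) := exists cl (wl : {ffun 'I_n -> R}), [/\ `|cl - c| <= eta,
  (forall i, 0 <= wl i <= wm i + eta),
  (forall lam', (forall i, `|lam' i - mu i| < r1) -> forall j, j != k ->
      cl - eta <= mix (wl k) (wl j) (lam' k) (lam' j)) &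
  forall i, T i = (alpha * cl^-1 * L) * wl i].
have step (N : 'I_n -> nat) mT : (forall i, L1 delta <= mT i <= hi i) -> (forall i, N i = cnat (mT i)) ->
    good (step_targets rho Theta alpha delta s N).2 /\
    forall i, (step_targets rho Theta alpha delta s N).2 i <= hi i.
  move=> hmT hN; have hE := empr N mT hmT hN; have [eM ek] := emp_max N hE.
  have hb' i : `|bvec delta s N k i - mu i| < r1.
    have -> : bvec delta s N k i - mu i =
       (emp s N i - mu i) + (if i == k then - eps delta else eps delta).
      by rewrite /bvec; case: ifP => _; rewrite addrAC.
    apply: (le_lt_trans (ler_normD _ _)).
    have -> : `|if i == k then - eps delta else eps delta| = eps delta.
      by case: ifP => _; rewrite ?normrN gtr0_norm.
    by have := hE i; lra.
  have [cl [wl [[bM bk] [clE wlE] hcl hwl hmix]]] := hr _ hb'.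
  have vb : valid_b rho Theta (bvec delta s N k) k.
    rewrite /valid_b asboolT//=; apply/forallP => j; apply/implyP; exact: bk.
  have ratio i : wl i / cl <= wm i / c + e1 / alpha.
    apply: (le_trans (ratio_perturb (wm1 i) c0 (hwl i) hcl et2)); rewrite lerD2l.
    rewrite ler_pdivrMr ?exprn_gt0// [leRHS]mulrAC ler_pdivlMr//.
    move: et3; rewrite ler_pdivlMr ?mulr_gt0//; lra.
  have hTi i : alpha * wl i * cl^-1 * L <= hi i.
    rewrite mulrC /hi ler_pM2l// -mulrA.
    apply: (le_trans (ler_wpM2l (ltW al0) (ratio i))).
    by rewrite mulrDr lerD2l mulrCA divff ?mulr1// gt_eqF.
  have TE : (step_targets rho Theta alpha delta s N).2 = fun i => alpha * wl i * cl^-1 * L.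
    rewrite /step_targets (istar_unique ek) vb /= clE wlE; apply/funext => i.
    by rewrite min_l// (le_trans (hTi i) (hiL2 i)).
  rewrite TE; split=> //; exists cl, wl; split=> // i.
  by rewrite -!mulrA; congr (_ * _); rewrite mulrCA [wl i * _]mulrC.
have [mT [T [[cl [wl [hcl hwl hmix TE]]] TmT hmT hN2]]] := N_stage2_ceil Lp L1hi step.
set N2 := N_stage2 rho Theta alpha delta s in hN2 *.
have hE := empr N2 mT hmT hN2; have [eM ek] := emp_max N2 hE.
have s0 : 0 < L1 delta by rewrite /L1 sqrtr_gt0.
have mT0 i : 0 < mT i by have /andP[h _] := hmT i; exact: lt_le_trans h.
have N2p i : (0 < N2 i)%N by rewrite hN2 -(ltr_nat R); apply: lt_le_trans (cnat_ge _).
have tau_le : (tau rho Theta alpha delta s)%:R <= L * (alpha / c + n%:R * e1) + n%:R.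
  rewrite /tau -/N2 natr_sum.
  apply: (@le_trans _ _ (\sum_(i < n) (hi i + 1))).
    apply: ler_sum => i _; rewrite hN2; have /andP[_ h] := hmT i.
    by have := cnat_lt (ltW (mT0 i)); lra.
  rewrite big_split/= sumr_const card_ord lerD2r /hi -mulr_sumr big_split/= sumr_const card_ord.
  rewrite -mulr_sumr -mulr_suml swm.2 div1r -[e1 *+ n]mulr_natl //.
have taup : (0 < tau rho Theta alpha delta s)%N.
  have h0 : (0 < n)%N by exact: leq_trans hn.
  by rewrite /tau (bigD1 (Ordinal h0))//= ltn_addr// N2p.
have stop : stop3 rho Theta alpha delta s.
  rewrite /stop3 -/N2 (istar_unique ek); apply/forallP => j; apply/implyP => jk.
  rewrite ZijE//; last exact/ltW/ek.
  (* Halfway between [L] and [alpha * L]: above the threshold, and below the guaranteed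
     [(alpha - (alpha - 1) / 4) * L]. *)
  rewrite lee_fin; apply: (@le_trans _ _ ((1 + (alpha - 1) / 2) * L)).
    apply: hb => //; apply: (le_trans tau_le); rewrite -/L mulrDl [L * _]mulrC lerD2l.
    by rewrite ler_peMr// ltW.
  have cl0 : 0 < cl by move: hcl; rewrite ler_distl => /andP[h _]; lra.
  have s1 : 0 < alpha * cl^-1 * L by rewrite !mulr_gt0// invr_gt0.
  (* Pull counts dominate the last targets, so monotonicity reduces the statistic to the targets,
     and homogeneity then to the weights. *)
  apply: (@le_trans _ _ (mix (T k) (T j) (emp s N2 k) (emp s N2 j))); last first.
    have T0 i : 0 <= T i by rewrite TE mulr_ge0// ?(ltW s1)//; have /andP[] := hwl i.
    have TN i : T i <= (N2 i)%:R by rewrite hN2; exact: le_trans (TmT i) (cnat_ge _).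
    by apply: (breg_mix_mono H) => //; exact/ltW/ek.
  rewrite !TE breg_mix_scale ?gt_eqF//.
  have hlt i : `|emp s N2 i - mu i| < r1 by exact: le_lt_trans lt12.
  apply: le_trans (ler_wpM2l (ltW s1) (hmix _ hlt j jk)).
  have -> : alpha * cl^-1 * L * (cl - eta) = (alpha - alpha * eta / cl) * L.
    by field; rewrite gt_eqF.
  rewrite ler_wpM2r ?(ltW Lp)//.
  have : alpha * eta / cl <= (alpha - 1) / 4.
    rewrite ler_pdivrMr//; move: et1; rewrite ler_pdivlMr ?mulr_gt0//.
    have : (alpha - 1) / 4 * (c / 2) <= (alpha - 1) / 4 * cl.
      rewrite ler_wpM2l ?divr_ge0//; first by lra.
      by move: hcl; rewrite ler_distl => /andP[h _]; lra.
    lra.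
  lra.
rewrite /Ntotal stop; apply: (le_trans tau_le).
rewrite ne1; apply: linear_absorb.
by apply: le_half_mul; rewrite -ler_pdivrMr.
Qed.

End run.

(** * Concentration of the empirical means *)

Section expfam_bregman.
Context {R : realType} (rho : {measure set R -> \bar R}) (Theta : set R).
Hypothesis hTheta : is_open_interval Theta.
Hypothesis hfin : forall th, Theta th -> (\int[rho]_x (expR (x * th))%:E < +oo)%E.
Hypothesis hder : forall th, Theta th -> derivable (bfun rho) th 1.
Hypothesis rho0 : rho setT != 0%E.
Hypothesis hinj : {in Theta &, injective (meanmap rho)}.
Hypothesis hM : is_open_interval (Mset rho Theta).

Local Notation B := (bfun rho).
Local Notation theta := (theta_of rho Theta).
Local Notation M := (Mset rho Theta).

Lemma expfam_bregman_family : bregman_family M theta (B \o theta).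
Proof.
split.
- exact: open_interval_between.
- by move=> x y; exact: theta_of_lt.
- move=> x y Mx My; rewrite /breg /=.
  have [T1 e1] := theta_ofP Mx; have [T2 e2] := theta_ofP My.
  by have := bfun_tangent hTheta hfin hder rho0 T1 T2; rewrite e1 subr_ge0.
- by move=> m e Mm e0; exact: theta_of_continuous.
Qed.

Lemma dKL_breg x y : M x -> M y -> dKL rho Theta x y = (breg theta (B \o theta) x y)%:E.
Proof. by move=> Mx My; rewrite dKLE. Qed.

Lemma theta_meanmap t : Theta t -> theta (meanmap rho t) = t.
Proof.
move=> Tt; have Mt : M (meanmap rho t) by exists t.
have [T1 e1] := theta_ofP Mt.
exact: (hinj (mem_set T1) (mem_set Tt) e1).
Qed.

(** The tangent at the shifted parameter bounds the increment by [h] times the shifted mean, which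
    is within [r] of [x] by continuity of [meanmap]. This controls the log-moment generating
    function of a centred sample. *)
Lemma bfun_increment_le x r : M x -> 0 < r -> exists2 h0 : R, 0 < h0 & forall h, `|h| <= h0 ->
  Theta (theta x + h) /\ B (theta x + h) - B (theta x) - h * x <= `|h| * r.
Proof.
move=> Mx r0; have [T0 e0] := theta_ofP Mx.
have cid t : M t -> {for t, continuous (@idfun R)} by move=> _; exact: cvg_id.
have gP t : Theta t -> M (meanmap rho t) /\ theta (meanmap rho t) = t.
  by move=> Tt; split; [exists t|exact: theta_meanmap].
have fM y : M y -> Theta (theta y) by case/theta_ofP.
have [q q0 hq] := increasing_section_continuous hM hTheta fM gP
  (fun y y' => @theta_of_lt _ _ _ hTheta hfin hder rho0 hinj y y') cid T0 r0.
exists (q / 2); first by rewrite divr_gt0.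
move=> h hh; have hq' : `|theta x + h - theta x| < q.
  by rewrite addrC addKr; apply: (le_lt_trans hh); rewrite ltr_pdivrMr// mulr_natr mulr2n ltrDr.
have [Th mh _] := hq _ hq'; split=> //.
have := bfun_tangent hTheta hfin hder rho0 Th T0.
rewrite e0 in mh; have -> : theta x - (theta x + h) = - h by rewrite opprD addNKr.
move=> tan; have : h * (meanmap rho (theta x + h) - x) <= `|h| * r.
  by apply: (le_trans (ler_norm _)); rewrite normrM ler_wpM2l// ltW.
move: tan; move: (B _) (B _) (meanmap _ _) => b1 b2 m tan; clear -tan; lra.
Qed.

End expfam_bregman.

Lemma tilt_exponent_le {R : realType} (N : nat) (c1 c2 h x r : R) :
  c1 - c2 - h * x <= `|h| * (r / 2) ->
  N%:R * (c1 - c2) + - (h * N%:R * x + `|h| * N%:R * r) <= - (N%:R * (`|h| * r / 2)).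
Proof.
move=> hyp; have := ler_wpM2l (ler0n R N) hyp; lra.
Qed.

Section concentration.
Context {R : realType} (rho : {measure set R -> \bar R}) (Theta : set R).
Hypothesis hTheta : is_open_interval Theta.
Hypothesis hfin : forall th, Theta th -> (\int[rho]_x (expR (x * th))%:E < +oo)%E.
Hypothesis hder : forall th, Theta th -> derivable (bfun rho) th 1.
Hypothesis hinj : {in Theta &, injective (meanmap rho)}.
Hypothesis hM : is_open_interval (Mset rho Theta).
Local Notation B := (bfun rho).
Local Notation theta := (theta_of rho Theta).
Local Notation M := (Mset rho Theta).
Context {d : measure_display} {Omega : measurableType d} (P : probability Omega R).
Variables (n : nat) (mu : 'I_n -> R) (X : 'I_n * nat -> Omega -> R).
Hypothesis muM : forall i, M (mu i).
Hypothesis hXmeas : forall p, measurable_fun setT (X p).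
Hypothesis hXindep : indep_family P X.
Hypothesis hXlaw : forall (i : 'I_n) (k : nat) (A : set R), measurable A ->
  P (X (i, k) @^-1` A) = nu rho (theta (mu i)) A.

(** A null reference measure would give the law of a sample total mass [0] instead of [1]. *)
Lemma law_rho_neq0 (i : 'I_n) : rho setT != 0%E.
Proof.
apply/eqP => r0; have := hXlaw i 0 measurableT.
rewrite preimage_setT probability_setT /nu (ge0_negligible_integral measurableT measurableT)//.
- by rewrite setDv integral_set0 => /eqP; rewrite gt_eqF// lte01.
- apply/measurable_EFinP; apply: measurableT_comp; first exact: measurable_expR.
  by apply: measurable_funB => //; exact: measurable_funM.
- by move=> x _; rewrite lee_fin expR_ge0.
Qed.

Let mexp (h : R) : measurable_fun [set: R] (fun x : R => expR (x * h)).
Proof.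
apply: measurableT_comp; first exact: measurable_expR.
by apply: measurable_funM.
Qed.

Lemma law_mgf i k h : Theta (theta (mu i) + h) ->
  (\int[P]_w (expR (X (i, k) w * h))%:E = (expR (B (theta (mu i) + h) - B (theta (mu i))))%:E)%E.
Proof.
move=> Th; have [T0 _] := theta_ofP (muM i).
rewrite -(dens_mgf hfin (law_rho_neq0 i) T0 Th).
rewrite -(@integral_mul_comp_transfer R _ _ _ _ P rho (fun=> 1) (X (i, k))
  (dens rho (theta (mu i))) id (fun x => expR (x * h)))//.
- by apply: eq_integral => w _; rewrite mul1r.
- by move=> x; exact: expR_ge0.
- apply: measurableT_comp; first exact: measurable_expR.
  by apply: measurable_funB => //; exact: measurable_funM.
- move=> A mA; rewrite (eq_integral (fun w => (\1_(X (i, k) @^-1` A) w)%:E)); last first.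
    by move=> w _; rewrite mul1r.
  have mXA : measurable (X (i, k) @^-1` A) by rewrite -[_ @^-1` _]setTI; exact: hXmeas.
  transitivity (P (X (i, k) @^-1` A)); first by rewrite integral_indic// setIT.
  rewrite hXlaw// /nu [LHS]integral_mkcond.
  apply: eq_integral => x _; rewrite patchE indicE.
  by case: (x \in A); rewrite ?mulr1 ?mulr0.
Qed.

Lemma sample_sum_mgf i N h : Theta (theta (mu i) + h) ->
  (\int[P]_w (expR (h * \sum_(k < N) X (i, val k) w))%:E =
   (expR (N%:R * (B (theta (mu i) + h) - B (theta (mu i)))))%:E)%E.
Proof.
move=> Th.
pose s : seq ('I_n * nat) := [seq (i, k) | k <- index_iota 0 N].
have us : uniq s by rewrite map_inj_uniq ?iota_uniq// => a b [].
(* The product formula wants a finite expectation at every index; the exponent [0] makes the factors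
   of the other arms equal to one. *)
pose f (p : 'I_n * nat) (x : R) := expR (x * (if p.1 == i then h else 0)).
pose c := B (theta (mu i) + h) - B (theta (mu i)).
have ffin p : (\int[P]_w (f p (X p w))%:E < +oo)%E.
  case: p => [j k]; rewrite /f /=; case: eqP => [->|_]; first by rewrite law_mgf// ltry.
  rewrite (eq_integral (cst 1%E)).
    rewrite integral_cst// mul1e.
    exact: le_lt_trans (probability_le1 P measurableT) (ltry _).
  by move=> w _; rewrite mulr0 expR0.
have pr := indep_expectation_prod hXindep hXmeas (fun p x => expR_ge0 _)
  (fun p => mexp (if p.1 == i then h else 0)) ffin us.
transitivity (\int[P]_w (\prod_(p <- s) f p (X p w))%:E)%E.
  apply: eq_integral => w _; rewrite big_map /f /= big_mkord mulr_sumr expR_sum.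
  by congr EFin; apply: eq_bigr => k _; rewrite eqxx mulrC.
rewrite [LHS]pr big_map (eq_bigr (fun=> (expR c)%:E)); last first.
  by move=> k _; rewrite eqxx law_mgf.
have prod_cst (l : seq nat) : (\prod_(k <- l) (expR c)%:E = (expR ((size l)%:R * c))%:E)%E.
  elim: l => [|k l IH]; first by rewrite big_nil mul0r expR0.
  by rewrite big_cons IH -EFinM -expRD /= mulrS mulrDl mul1r.
by rewrite prod_cst size_iota subn0.
Qed.


(* Sum of the two exponential tilts that dominate the indicator of [|S_N / N - mu i| > r]. *)
Definition tilt_sum (h r : R) (i : 'I_n) (N : nat) (w : Omega) : R :=
  expR (h * \sum_(k < N) X (i, val k) w) * expR (- (h * N%:R * mu i + h * N%:R * r)) +
  expR (- h * \sum_(k < N) X (i, val k) w) * expR (h * N%:R * mu i - h * N%:R * r).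

Lemma tilt_sum_ge0 h r i N w : 0 <= tilt_sum h r i N w.
Proof. by rewrite addr_ge0// mulr_ge0 ?expR_ge0. Qed.

Lemma tilt_sum_ge1 h r i N w : 0 < h -> (0 < N)%N ->
  r < `|(\sum_(k < N) X (i, val k) w) / N%:R - mu i| -> 1 <= tilt_sum h r i N w.
Proof.
move=> h0 N0; rewrite /tilt_sum -!expRD; move: (\sum_(k < N) _) => S.
have N0' : (0 : R) < N%:R by rewrite ltr0n.
have hN : 0 < h * N%:R by rewrite mulr_gt0.
have [z ->] : exists z, S = z * N%:R by exists (S / N%:R); rewrite divfK// gt_eqF.
rewrite mulfK ?gt_eqF//; move: (mu i) => m.
rewrite ltr_normr => /orP[zr|zr].
  apply: (@le_trans _ _ (expR (h * (z * N%:R) + - (h * N%:R * m + h * N%:R * r)))).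
    rewrite -[X in X <= _]expR0 ler_expR.
    have -> : h * (z * N%:R) + - (h * N%:R * m + h * N%:R * r) = h * N%:R * (z - m - r) by ring.
    by rewrite mulr_ge0// ?subr_ge0 ltW.
  by rewrite lerDl expR_ge0.
apply: (@le_trans _ _ (expR (- h * (z * N%:R) + (h * N%:R * m - h * N%:R * r)))).
  rewrite -[X in X <= _]expR0 ler_expR.
  have -> : - h * (z * N%:R) + (h * N%:R * m - h * N%:R * r) = h * N%:R * (- (z - m) - r) by ring.
  by rewrite mulr_ge0// ?subr_ge0 ltW.
by rewrite lerDr expR_ge0.
Qed.

Let mS i N h : measurable_fun [set: Omega] (fun w => expR (h * \sum_(k < N) X (i, val k) w)).
Proof.
apply: measurableT_comp; first exact: measurable_expR.
apply: measurable_funM => //.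
rewrite (_ : (fun w => _) = (fun w => \sum_(k <- index_enum 'I_N) X (i, val k) w))//.
exact: measurable_sum.
Qed.

Lemma measurable_tilt_sum h r i N : measurable_fun [set: Omega] (tilt_sum h r i N).
Proof. by apply: measurable_funD; apply: measurable_funM. Qed.

(** Per sample, a deviation [r] gains [h * r] in the exponent and the log-moment generating function
    gives back at most [h * r / 2]. The smallest of the tilts found for each arm works for all. *)
Lemma tilt_sum_expectation r : 0 < r -> exists2 h : R, 0 < h & forall i N,
  (\int[P]_w (tilt_sum h r i N w)%:E <= (2 * expR (- (N%:R * (h * r / 2))))%:E)%E.
Proof.
move=> r0; have r20 : 0 < r / 2 by rewrite divr_gt0.
pose Q i (h0 : R) := forall h, `|h| <= h0 -> Theta (theta (mu i) + h) /\
  B (theta (mu i) + h) - B (theta (mu i)) - h * mu i <= `|h| * (r / 2).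
have [||h h0 hQ] := @ex_pos_forall R n Q.
- by move=> i a b Qa _ ba h hb; apply: Qa; exact: le_trans ba.
- move=> i; have r0' := law_rho_neq0 i.
  exact: (bfun_increment_le hTheta hfin hder r0' hinj hM (muM i) r20).
exists h => // i N; have [hp hm] : `|h| <= h /\ `|- h| <= h by rewrite normrN gtr0_norm.
have [T1 b1] := hQ i h hp; have [T2 b2] := hQ i (- h) hm.
rewrite normrN in b2; rewrite gtr0_norm// in b1 b2.
have ge0 a b w : (0 <= (expR (a * \sum_(k < N) X (i, val k) w) * expR b)%:E)%E.
  by rewrite lee_fin mulr_ge0 ?expR_ge0.
have me a b : measurable_fun [set: Omega] (fun w => (expR (a * \sum_(k < N) X (i, val k) w) * expR b)%:E).
  by apply/measurable_EFinP; apply: measurable_funM.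
have tiltE a b : Theta (theta (mu i) + a) ->
  (\int[P]_w (expR (a * \sum_(k < N) X (i, val k) w) * expR b)%:E =
   (expR (N%:R * (B (theta (mu i) + a) - B (theta (mu i))) + b))%:E)%E.
  move=> Ta; under eq_integral do rewrite EFinM.
  rewrite ge0_integralZr ?lee_fin ?expR_ge0//.
  - by rewrite sample_sum_mgf// -EFinM -expRD.
  - by apply/measurable_EFinP.
rewrite (eq_integral (fun w =>
  ((expR (h * \sum_(k < N) X (i, val k) w) * expR (- (h * N%:R * mu i + h * N%:R * r)))%:E +
   (expR (- h * \sum_(k < N) X (i, val k) w) * expR (h * N%:R * mu i - h * N%:R * r))%:E)%E)); last first.
  by move=> w _; rewrite -EFinD.
rewrite ge0_integralD//.
rewrite [X in (X + _)%E](tiltE h _ T1) [X in (_ + X)%E](tiltE (- h) _ T2) -EFinD lee_fin.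
have two (x : R) : 2 * x = x + x by rewrite mulr_natl mulr2n.
rewrite [leRHS]two; apply: lerD; rewrite ler_expR.
- have := @tilt_exponent_le R N _ _ h (mu i) r; rewrite gtr0_norm//; exact.
- have := @tilt_exponent_le R N _ _ (- h) (mu i) r; rewrite normrN gtr0_norm// => /(_ _ _ b2).
  apply: le_trans; rewrite lerD2l -subr_ge0.
  by rewrite (_ : _ - _ = 0)//; ring.
Qed.

End concentration.

(** * Bound on the expected number of pulls *)

Lemma TstarMuE {R : realType} (rho : {measure set R -> \bar R}) (Theta : set R) n
    (mu : 'I_n -> R) k : unique_max mu k ->
  TstarMu rho Theta mu = (fine (Tinv rho Theta mu k))^-1.
Proof.
move=> muk; rewrite /TstarMu; case: pickP => [k' /forallP hk'|/(_ k) /negP[]]; last first.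
  by apply/forallP => j; apply/implyP; exact: muk.
have [->//|kk'] := eqVneq k' k.
have := hk' k; rewrite eq_sym kk' /= => h; have := muk _ kk'.
by rewrite ltNge (ltW h).
Qed.

(** With [x] the cap on the pulls of one arm, the left side is the worst-case number of pulls times
    the number of pairs of an arm and a count times the Chernoff bound at [sqrt L] pulls. The
    polynomial part has degree [8] in [sqrt L], so the eighth Taylor term of the exponential is
    enough. *)
Lemma tail_contribution_small {R : realType} (n : nat) (a e : R) : 0 < a -> 0 < e ->
  exists2 L0 : R, 1 <= L0 & forall L x : R, L0 <= L -> 0 <= x -> x <= L ^+ 2 + 1 ->
    n%:R * x * (n%:R * (x + 1) * (2 * expR (- (Num.sqrt L * a)))) <= e * L.
Proof.
(* [12] is [2 * 6]: the two tilts, and the bound [x * (x + 1) <= 6 * u ^+ 8]. *)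
move=> a0 e0; pose C : R := 12 * n%:R ^+ 2 * 8`!%:R / (e * a ^+ 8).
have C0 : 0 <= C by rewrite divr_ge0 ?mulr_ge0 ?exprn_ge0// ltW.
exists (1 + C); first by rewrite lerDl.
move=> L x hL x0 xL; have L1 : 1 <= L by lra.
have CL : C <= L by lra.
pose u := Num.sqrt L; have uL : u ^+ 2 = L by rewrite sqr_sqrtr//; lra.
have u0 : 0 < u by rewrite sqrtr_gt0; lra.
have L2 : 1 <= L ^+ 2 by rewrite exprn_ege1.
have xx : x * (x + 1) <= 6 * u ^+ 8.
  have -> : u ^+ 8 = L ^+ 2 * L ^+ 2 by rewrite -uL; ring.
  have h1 : x <= 2 * L ^+ 2 by lra.
  have h2 : x + 1 <= 3 * L ^+ 2 by lra.
  have := ler_pM x0 (addr_ge0 x0 ler01) h1 h2; lra.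
have ua0 : 0 <= u * a by rewrite mulr_ge0 ?ltW.
have E := expR_ge1Dxn 7 ua0.
have f0 : (0 : R) < 8`!%:R by rewrite ltr0n fact_gt0.
have E8 : (u * a) ^+ 8 <= 8`!%:R * expR (u * a).
  by rewrite -ler_pdivrMl// mulrC; apply: le_trans E; rewrite lerDr.
rewrite expRN -/u.
have -> : n%:R * x * (n%:R * (x + 1) * (2 * (expR (u * a))^-1)) =
  2 * n%:R ^+ 2 * (x * (x + 1)) / expR (u * a) by field; rewrite gt_eqF ?expR_gt0.
rewrite ler_pdivrMr ?expR_gt0//.
have n2 : 0 <= 2 * n%:R ^+ 2 :> R by rewrite mulr_ge0// exprn_ge0.
apply: (le_trans (ler_wpM2l n2 xx)).
have K : C * (e * a ^+ 8) = 12 * n%:R ^+ 2 * 8`!%:R.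
  by rewrite /C divfK// gt_eqF// mulr_gt0// exprn_gt0.
have ea : 0 < e * a ^+ 8 by rewrite mulr_gt0// exprn_gt0.
have K2 : 12 * n%:R ^+ 2 * 8`!%:R <= L * (e * a ^+ 8) by rewrite -K ler_pM2r.
rewrite -(ler_pM2r f0).
have u8 : 0 <= u ^+ 8 by rewrite exprn_ge0// ltW.
have s1 := ler_wpM2r u8 K2.
have eL : 0 <= e * L by rewrite mulr_ge0//; lra.
have s2 := ler_wpM2l eL E8.
rewrite exprMn in s2.
move: (8`!%:R : R) (expR (u * a)) (u ^+ 8) (a ^+ 8) s1 s2 => F Ex U A s1 s2.
clear -s1 s2; lra.
Qed.

Theorem mainTheorem1 (R : realType) (rho : {measure set R -> \bar R}) (Theta : set R)
  (hTheta : is_open_interval Theta)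
  (hfin : forall th, Theta th -> (\int[rho]_x (expR (x * th))%:E < +oo)%E)
  (hder : forall th, Theta th -> derivable (bfun rho) th 1)
  (hinj : {in Theta &, injective (meanmap rho)})
  (hM : is_open_interval (Mset rho Theta))
  (n : nat) (hn : (2 <= n)%N) (mu : 'I_n -> R)
  (hmuM : forall i, Mset rho Theta (mu i))
  (hmu1 : forall i j : 'I_n, nat_of_ord i = 0%N -> (0 < j)%N -> mu j < mu i)
  (hmusort : forall i j : 'I_n, (i <= j)%N -> mu j <= mu i)
  (alpha : R) (halpha : 1 < alpha <= expR 1 / 2)
  (d : measure_display) (Omega : measurableType d) (P : probability Omega R)
  (X : 'I_n * nat -> Omega -> R)
  (hXmeas : forall p, measurable_fun setT (X p))
  (hXindep : indep_family P X)
  (hXlaw : forall (i : 'I_n) (k : nat) (B : set R), measurable B ->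
     P (X (i, k) @^-1` B) = nu rho (theta_of rho Theta (mu i)) B) :
  forall e : R, 0 < e -> exists delta0 : R, 0 < delta0 /\
    forall delta : R, 0 < delta -> delta < delta0 -> delta < expR (- expR 1) ->
      (\int[P]_w ((Ntotal rho Theta alpha delta (fun i k => X (i, k) w))%:R)%:E
        <= ((alpha * TstarMu rho Theta mu + e) * ln delta^-1)%:E)%E.
Proof.
move=> e e0; have n0 : (0 < n)%N by exact: leq_trans hn.
pose k : 'I_n := Ordinal n0.
have muk : unique_max mu k.
  move=> j jk; apply: hmu1 => //; rewrite lt0n; apply: contra_neq jk => j0.
  exact: val_inj.
rewrite (TstarMuE rho Theta muk).
have rho0 := law_rho_neq0 hXlaw k.
have Hb := expfam_bregman_family hTheta hfin hder rho0 hinj hM.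
have dE := dKL_breg hTheta hfin hder rho0.
have [c [wm [Tc c0 swm stab]]] := chartime_stable_ex Hb dE hn hmuM muk.
rewrite Tc; have al1 : 1 < alpha by case/andP: halpha.
have e20 : 0 < e / 2 by rewrite divr_gt0.
have [r r0 [La La1 hgood]] := Ntotal_good Hb dE hn c0 swm stab al1 e20.
have [h h0 htilt] := tilt_sum_expectation hTheta hfin hder hinj hM hmuM hXmeas hXindep hXlaw r0.
have a0 : 0 < h * r / 2 by rewrite divr_gt0// mulr_gt0.
have [Lt Lt1 htail] := tail_contribution_small n a0 e20.
exists (expR (- (La + Lt))); split; first exact: expR_gt0.
move=> delta d0 dlt _.
have Lbig : La + Lt <= ln delta^-1.
  rewrite lnV ?posrE// lerNr -[X in _ <= X](expRK (- (La + Lt))).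
  by rewrite ler_ln ?posrE ?expR_gt0// ltW.
have LE : ln delta^-1 = logd delta by [].
rewrite LE in Lbig *.
have LaL : La <= logd delta by apply: le_trans Lbig; rewrite lerDl; exact: le_trans Lt1.
have LtL : Lt <= logd delta by apply: le_trans Lbig; rewrite lerDr; exact: le_trans La1.
have logd1 : 1 <= logd delta by exact: le_trans LaL.
pose m0 := cnat (L1 delta); pose cap := cnat (L3 delta).
(* All arms with all counts at which accuracy is required, so that the random count of an arm is
   covered by a union bound. *)
pose s : seq ('I_n * nat) := [seq (i, N) | i <- enum 'I_n, N <- index_iota m0 cap.+1].
pose W (p : 'I_n * nat) w := tilt_sum mu X h r p.1 p.2 w.
have W0 p w : 0 <= W p w by exact: tilt_sum_ge0.
pose bad := (n * cap)%N.
have m00 : (0 < m0)%N.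
  rewrite -(ltr_nat R); apply: lt_le_trans (cnat_ge _).
  by rewrite /L1 sqrtr_gt0; exact: lt_le_trans logd1.
have A0 : 0 <= (alpha / c + e / 2) * logd delta.
  by rewrite mulr_ge0 ?addr_ge0 ?divr_ge0// ltW//; exact: lt_trans al1 || exact: lt_le_trans logd1.
(* Whenever some empirical mean is off by more than [r], its own tilt sum is at least one and pays
   for the worst case [bad]. *)
have pointwise w : (Ntotal rho Theta alpha delta (fun i k => X (i, k) w))%:R <=
    (alpha / c + e / 2) * logd delta + bad%:R * \sum_(p <- s) W p w.
  have S0 : 0 <= \sum_(p <- s) W p w by apply: sumr_ge0.
  have [hg|hb] := pselect (forall i (N : 'I_n -> nat), (m0 <= N i)%N -> (N i <= cap)%N ->
       `|emp (fun i k => X (i, k) w) N i - mu i| <= r).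
    apply: (le_trans (hgood _ _ d0 LaL hg)).
    by rewrite lerDl mulr_ge0.
  apply: ler_wpDl => //.
  apply: (@le_trans _ _ bad%:R); first by rewrite ler_nat Ntotal_le.
  rewrite ler_peMr//.
  move: hb => /existsNP[i /existsNP[N /not_implyP[m0N /not_implyP[capN /negP]]]].
  rewrite -ltNge => dev.
  have ps : (i, N i) \in s.
    by apply/allpairsP; exists (i, N i); split => //=; rewrite ?mem_enum// mem_index_iota m0N ltnS.
  have W1 : 1 <= W (i, N i) w by apply: tilt_sum_ge1 => //; exact: leq_trans m0N.
  apply: (le_trans W1); rewrite (big_rem _ ps) /= lerDl; exact: sumr_ge0.
have mW p : measurable_fun [set: Omega] (fun w => (bad%:R%:E * (W p w)%:E)%E).
  by apply: measurable_funeM; apply/measurable_EFinP; exact: measurable_tilt_sum.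
have bW0 p w : (0 <= bad%:R%:E * (W p w)%:E)%E by rewrite mule_ge0 ?lee_fin.
apply: (@le_trans _ _ (\int[P]_w (((alpha / c + e / 2) * logd delta)%:E +
    \sum_(p <- s) bad%:R%:E * (W p w)%:E))%E).
  apply: le_ge0_integral_nomeas => w; first by rewrite lee_fin.
  rewrite (eq_bigr (fun p => (bad%:R * W p w)%:E))//.
  by rewrite sumEFin -EFinD lee_fin -mulr_sumr.
rewrite ge0_integralD//; last 2 first.
- by move=> w _; apply: sume_ge0.
- exact: emeasurable_sum.
have intc (x : R) : (\int[P]_w x%:E = x%:E)%E.
  rewrite integral_cst//.
  by transitivity (x%:E * 1)%E; [congr (_ * _)%E; exact: probability_setT | rewrite mule1].
rewrite intc ge0_integral_sum//.
have le1 p : p \in s -> (\int[P]_w (bad%:R%:E * (W p w)%:E) <=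
    (bad%:R * (2 * expR (- (Num.sqrt (logd delta) * (h * r / 2)))))%:E)%E.
  move=> /allpairsP[[i N] /= [_ ]]; rewrite mem_index_iota => /andP[m0N _] ->.
  rewrite ge0_integralZl ?lee_fin//; last 2 first.
  - by apply/measurable_EFinP; exact: measurable_tilt_sum.
  - by move=> w _; rewrite lee_fin.
  rewrite EFinM lee_wpmul2l ?lee_fin//; apply: (le_trans (htilt i N)).
  rewrite lee_fin ler_wpM2l// ler_expR lerN2 ler_wpM2r ?(ltW a0)//.
  by apply: (le_trans (cnat_ge (L1 delta))); rewrite ler_nat.
apply: (@le_trans _ _ (((alpha / c + e / 2) * logd delta)%:E +
   \sum_(p <- s) (bad%:R * (2 * expR (- (Num.sqrt (logd delta) * (h * r / 2)))))%:E)%E).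
  rewrite leeD2l// big_seq [leRHS]big_seq; apply: lee_sum => p ps; exact: le1.
rewrite sumEFin -EFinD lee_fin big_const_seq count_predT iter_addr addr0.
rewrite -[X in _ + X <= _]mulr_natr.
have sizes : (size s <= n * cap.+1)%N.
  by rewrite size_allpairs size_enum_ord leq_mul2l size_iota leq_subr orbT.
have cap0 : 0 <= (cap%:R : R) by exact: ler0n.
have capL : (cap%:R : R) <= logd delta ^+ 2 + 1.
  by apply/ltW/cnat_lt; rewrite /L3 sqr_ge0.
have T := htail _ _ LtL cap0 capL.
apply: (@le_trans _ _ ((alpha / c + e / 2) * logd delta + e / 2 * logd delta)); last first.
  by rewrite -mulrDl -addrA -splitr.
rewrite lerD2l; apply: le_trans T.
rewrite /bad natrM -[leLHS]mulrA; apply: ler_wpM2l; first by rewrite mulr_ge0.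
rewrite [leRHS]mulrC; apply: ler_wpM2l; first by rewrite mulr_ge0 ?expR_ge0.
by rewrite natr1 -natrM ler_nat.
Qed.
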